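(* Let $\Lambda$ be a row-finite $k$-graph without sources, let $\mathcal{G}_\Lambda$ be its path groupoid with canonical cocycle $c:\mathcal{G}_\Lambda\to\mathbb{Z}^k$, $c(x,n,y)=n$. Then the talented monoid $T_\Lambda$ is isomorphic, as a $\mathbb{Z}^k$-monoid, to the talented monoid $T_{\mathcal{G}_\Lambda}=\mathrm{Typ}(\mathcal{G}_\Lambda\times_c\mathbb{Z}^k)$ of the groupoid $\mathcal{G}_\Lambda$. Hence $T_\Lambda$ is a conical refinement monoid.
   Context: **$k$-graphs.** $\mathbb{N}=\{0,1,2,\dots\}$, $k\ge 1$, $e_i$ is the $i$-th standard generator of $\mathbb{N}^k$; $\mathbb{N}^k$ is ordered coordinatewise. A $k$-graph is a countable small category $\Lambda$ with object set $\Lambda^0$ (identified with the identity morphisms), range and source maps $r,s:\Lambda\to\Lambda^0$, and a functor $d:\Lambda\to\mathbb{N}^k$ with the unique factorization property: if $d(\lambda)=m+n$ there are unique $\mu_1,\mu_2\in\Lambda$ with $\lambda=\mu_1\mu_2$, $d(\mu_1)=m$, $d(\mu_2)=n$ (the product $\mu_1\mu_2$ is defined iff $s(\mu_1)=r(\mu_2)$). For $v\in\Lambda^0$, $n\in\mathbb{N}^k$: $v\Lambda^n=\{\lambda: r(\lambda)=v,\ d(\lambda)=n\}$. $\Lambda$ is row-finite if every $v\Lambda^n$ is finite, and has no sources if every $v\Lambda^n$ is nonempty. **Talented monoid.** $T_\Lambda$ is the commutative monoid generated by symbols $v(n)$ ($v\in\Lambda^0$, $n\in\mathbb{Z}^k$)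 subject to $v(n)=\sum_{\alpha\in v\Lambda^{e_i}}s(\alpha)(n+e_i)$ for all $v$, $n$ and $i\in\{1,\dots,k\}$ with $v\Lambda^{e_i}\neq\emptyset$. $\mathbb{Z}^k$ acts on $T_\Lambda$ by monoid automorphisms determined by ${}^{n}v(m)=v(m+n)$. A $\mathbb{Z}^k$-monoid is a commutative monoid with an action of $\mathbb{Z}^k$ by monoid automorphisms; isomorphisms of $\mathbb{Z}^k$-monoids are equivariant monoid isomorphisms. **Path groupoid.** Let $\Omega_k=\{(m,n)\in\mathbb{N}^k\times\mathbb{N}^k: m\le n\}$ be the $k$-graph with $r(m,n)=m$, $s(m,n)=n$, $(m,n)(n,p)=(m,p)$, $d(m,n)=n-m$. $\Lambda^\infty$ is the set of degree-preserving functors $x:\Omega_k\to\Lambda$; $x(m):=x(m,m)$, $r(x):=x(0)$, and $\sigma^p(x)(m,n)=x(m+p,n+p)$. For $\lambda\in\Lambda$ and $z\in\Lambda^\infty$ with $r(z)=s(\lambda)$, $\lambda z$ is the unique infinite path with $(\lambda z)(0,d(\lambda))=\lambda$ and $\sigma^{d(\lambda)}(\lambda z)=z$. $\mathcal{G}_\Lambda=\{(x,n-m,y): x,y\in\Lambda^\infty,\ n,m\in\mathbb{N}^k,\ \sigma^n(x)=\sigma^m(y)\}$ with unit space $\Lambda^\infty$, $r(x,n,y)=x$, $s(x,n,y)=y$, $(x,n,y)(y,m,w)=(x,n+m,w)$, $(x,n,y)^{-1}=(y,-n,x)$, and topology with basis the sets $Z(\lambda,\mu)=\{(\lambda z,d(\lambda)-d(\mu),\mu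 z): z\in\Lambda^\infty, r(z)=s(\lambda)\}$ for $\lambda,\mu\in\Lambda$ with $s(\lambda)=s(\mu)$. This is an ample Hausdorff groupoid. **Skew product.** $\mathcal{G}_\Lambda\times_c\mathbb{Z}^k$ has arrows $\mathcal{G}_\Lambda\times\mathbb{Z}^k$ (product topology, $\mathbb{Z}^k$ discrete), unit space $\Lambda^\infty\times\mathbb{Z}^k$, $r(g,\alpha)=(r(g),\alpha)$, $s(g,\alpha)=(s(g),\alpha+c(g))$, $(g,\alpha)(h,\alpha+c(g))=(gh,\alpha)$, $(g,\alpha)^{-1}=(g^{-1},\alpha+c(g))$. **Type monoid.** For an ample groupoid $\mathcal{G}$, $\mathrm{Typ}(\mathcal{G})$ is the commutative monoid generated by symbols $\mathrm{typ}(U)$, $U$ a compact open subset of $\mathcal{G}^{(0)}$, subject to: $\mathrm{typ}(\emptyset)=0$; $\mathrm{typ}(s(B))=\mathrm{typ}(r(B))$ for each compact open bisection $B$; $\mathrm{typ}(U\sqcup V)=\mathrm{typ}(U)+\mathrm{typ}(V)$ for disjoint $U,V$. $\mathbb{Z}^k$ acts on $\mathrm{Typ}(\mathcal{G}_\Lambda\times_c\mathbb{Z}^k)$ by ${}^{\gamma}\mathrm{typ}(U\times\{\alpha\})=\mathrm{typ}(U\times\{\gamma+\alpha\})$ for $U\subseteq\Lambda^\infty$ compact open, extended additively. A commutative monoid $M$ is conical if $x+y=0$ implies $x=y=0$; it is a refinement monoid if $a+b=c+d$ implies there are $z_1,z_2,z_3,z_4\in M$ with $a=z_1+z_2$, $b=z_3+z_4$,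 $c=z_1+z_3$, $d=z_2+z_4$. *)

(* Defs.v *)
From HB Require Import structures.
From mathcomp Require Import all_boot generic_quotient all_algebra.
From mathcomp Require Import boolp classical_sets functions cardinality filter topology.

Set Implicit Arguments.
Unset Strict Implicit.
Unset Printing Implicit Defensive.

Import GRing.Theory.

Local Open Scope classical_set_scope.
Local Open Scope quotient_scope.
Local Open Scope ring_scope.

Notation nvec k := {ffun 'I_k -> nat}.

Definition nle k (m n : nvec k) : bool := [forall i, (m i <= n i)%N].

Definition nsub k (n m : nvec k) : nvec k := [ffun i => (n i - m i)%N].

Definition nbasis k (i : 'I_k) : nvec k := [ffun j => (j == i : nat)].

Definition zvec (k : nat) : Type := discrete_topology {ffun 'I_k -> int}.

HB.instance Definition _ k := GRing.Zmodule.copy (zvec k) {ffun 'I_k -> int}.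
HB.instance Definition _ k :=
  DiscreteTopology.copy (zvec k) (discrete_topology {ffun 'I_k -> int}).

Definition zof k (n : nvec k) : zvec k := [ffun i => (n i)%:Z].

Section NVecTheory.
Variable k : nat.
Implicit Types m n p : nvec k.

Lemma nvecD m n i : (m + n) i = (m i + n i)%N.
Proof. by rewrite ffunE. Qed.

Lemma nsubE n m i : nsub n m i = (n i - m i)%N.
Proof. by rewrite ffunE. Qed.

Lemma nleP m n : reflect (forall i, (m i <= n i)%N) (nle m n).
Proof. exact: forallP. Qed.

Lemma nle_refl n : nle n n.
Proof. by apply/nleP. Qed.

Lemma nle0 n : nle 0 n.
Proof. by apply/nleP => i; rewrite ffunE. Qed.

Lemma nle_trans n m p : nle m n -> nle n p -> nle m p.
Proof.
by move=> /nleP mn /nleP np; apply/nleP => i; apply: leq_trans (np i).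
Qed.

Lemma nle_add m n : nle m (m + n).
Proof. by apply/nleP => i; rewrite nvecD leq_addr. Qed.

Lemma nle_add2r p m n : nle (m + p) (n + p) = nle m n.
Proof. by apply: eq_forallb => i; rewrite !nvecD leq_add2r. Qed.

Lemma nsubK m n : nle m n -> m + nsub n m = n.
Proof. by move=> /nleP mn; apply/ffunP => i; rewrite nvecD nsubE subnKC. Qed.

Lemma nsub_addl m n : nsub (m + n) m = n.
Proof. by apply/ffunP => i; rewrite nsubE nvecD addKn. Qed.

Lemma nsub_add2r p m n : nsub (n + p) (m + p) = nsub n m.
Proof. by apply/ffunP => i; rewrite !nsubE !nvecD subnDr. Qed.

Lemma nsubnn n : nsub n n = 0.
Proof. by apply/ffunP => i; rewrite !ffunE subnn. Qed.

Lemma nsub_trans n m p : nle m n -> nle n p ->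
  nsub p m = nsub n m + nsub p n.
Proof.
move=> /nleP mn /nleP np; apply/ffunP => i.
by rewrite nvecD !nsubE addnC addnBA // subnK.
Qed.

Lemma nvec_addrI m : injective (+%R m).
Proof.
by move=> n p /ffunP mnp; apply/ffunP => i; have := mnp i;
  rewrite !nvecD => /addnI.
Qed.

Lemma nsub_join m n : m + nsub n m = n + nsub m n.
Proof.
by apply/ffunP => i; rewrite !nvecD !nsubE -!maxnE maxnC.
Qed.

Lemma zofD m n : zof (m + n) = zof m + zof n.
Proof. by apply/ffunP => i; rewrite !ffunE PoszD. Qed.

Lemma zof0 : zof 0 = 0 :> zvec k.
Proof. by apply/ffunP => i; rewrite !ffunE. Qed.

Lemma zof_inj : injective (@zof k).
Proof.
by move=> m n /ffunP mn; apply/ffunP => i; have := mn i; rewrite !ffunE => -[].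
Qed.

End NVecTheory.

(* [comp l m] is the product of [l] and [m], read as in [l m]: it is
   meaningful when [src l = rng m], and nothing is required of it (and
   nothing below uses it) otherwise. *)
Record kgraph (k : nat) := KGraph {
  kobj : countType;
  kmor : countType;
  rng : kmor -> kobj;
  src : kmor -> kobj;
  idm : kobj -> kmor;
  comp : kmor -> kmor -> kmor;
  deg : kmor -> nvec k;
  rng_id : forall v, rng (idm v) = v;
  src_id : forall v, src (idm v) = v;
  rng_comp : forall l m, src l = rng m -> rng (comp l m) = rng l;
  src_comp : forall l m, src l = rng m -> src (comp l m) = src m;
  comp_idl : forall l, comp (idm (rng l)) l = l;
  comp_idr : forall l, comp l (idm (src l)) = l;
  compA : forall l m n, src l = rng m -> src m = rng n ->
    comp l (comp m n) = comp (comp l m) n;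
  deg_id : forall v, deg (idm v) = 0;
  deg_comp : forall l m, src l = rng m -> deg (comp l m) = deg l + deg m;
  factorization : forall l m n, deg l = m + n ->
    exists! p : kmor * kmor,
      [/\ src p.1 = rng p.2, comp p.1 p.2 = l, deg p.1 = m & deg p.2 = n]
}.

Definition vpaths k (L : kgraph k) (v : kobj L) (n : nvec k) : set (kmor L) :=
  [set l | rng l = v /\ deg l = n].

Definition row_finite k (L : kgraph k) : Prop :=
  forall (v : kobj L) n, finite_set (vpaths v n).

Definition no_sources k (L : kgraph k) : Prop :=
  forall (v : kobj L) n, vpaths v n !=set0.

Record kfunctor k (L M : kgraph k) := KFunctor {
  fobj : kobj L -> kobj M;
  fmor : kmor L -> kmor M;
  fmor_rng : forall l, rng (fmor l) = fobj (rng l);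
  fmor_src : forall l, src (fmor l) = fobj (src l);
  fmor_id : forall v, fmor (idm v) = idm (fobj v);
  fmor_comp : forall l m, src l = rng m ->
    fmor (comp l m) = comp (fmor l) (fmor m);
  fmor_deg : forall l, deg (fmor l) = deg l
}.

Lemma kfunctorP k (L M : kgraph k) (x y : kfunctor L M) :
  fmor x =1 fmor y -> x = y.
Proof.
case: x y => [xo xm xr xs xi xc xd] [yo ym yr ys yi yc yd] /= xy.
have {}xy : xm = ym by apply/funext.
move: xr xs xi xc xd yr ys yi yc yd; rewrite xy => xr xs xi xc xd yr ys yi yc yd.
have xyo : xo = yo.
  by apply/funext => v; rewrite -{1}(rng_id v) -xr yr rng_id.
subst yo ym.
by congr KFunctor; apply: Prop_irrelevance.
Qed.

Definition kfunctor_comp k (L M N : kgraph k)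
  (g : kfunctor M N) (f : kfunctor L M) : kfunctor L N.
Proof.
refine (@KFunctor k L N (fobj g \o fobj f) (fmor g \o fmor f) _ _ _ _ _).
- by move=> l /=; rewrite !fmor_rng.
- by move=> l /=; rewrite !fmor_src.
- by move=> v /=; rewrite !fmor_id.
- by move=> l m lm /=; rewrite !fmor_comp // fmor_rng fmor_src lm.
- by move=> l /=; rewrite !fmor_deg.
Defined.

Section Omega.
Variable k : nat.

Definition omega_mor : countType := {p : nvec k * nvec k | nle p.1 p.2}.

Definition omor (m n : nvec k) (mn : nle m n) : omega_mor :=
  exist (fun p => nle p.1 p.2) (m, n) mn.

Definition omega_comp (a b : omega_mor) : omega_mor :=
  insubd a ((val a).1, (val b).2).

Lemma omega_compE (a b : omega_mor) : (val a).2 = (val b).1 ->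
  val (omega_comp a b) = ((val a).1, (val b).2).
Proof.
move=> ab; rewrite insubdK // unfold_in /=.
by apply: nle_trans (valP a) _; rewrite ab; exact: (valP b).
Qed.

Definition Omega : kgraph k.
Proof.
refine (@KGraph k (nvec k : countType) omega_mor
  (fun a => (val a).1) (fun a => (val a).2)
  (fun n => omor (nle_refl n)) omega_comp
  (fun a => nsub (val a).2 (val a).1) _ _ _ _ _ _ _ _ _ _) => //.
- by move=> a b ab; rewrite omega_compE.
- by move=> a b ab; rewrite omega_compE.
- by move=> a; apply: val_inj; rewrite omega_compE //; case: (val a).
- by move=> a; apply: val_inj; rewrite omega_compE //; case: (val a).
- move=> a b c ab bc; apply: val_inj.
  by rewrite !(omega_compE, ab, bc).
- by move=> n; rewrite /= nsubnn.
- move=> a b ab; rewrite omega_compE //= (@nsub_trans _ (val a).2) ?ab //.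
    by rewrite -ab; exact: (valP a).
  exact: (valP b).
- case=> -[p q] /= pq m n dpq.
  have qE : q = p + m + n by rewrite -addrA -dpq nsubK.
  have pm : nle p (p + m) by exact: nle_add.
  have mq : nle (p + m) q by rewrite qE nle_add.
  exists (omor pm, omor mq); split.
    split=> //=; last by rewrite qE nsub_addl.
      by apply: val_inj; rewrite omega_compE.
    by rewrite nsub_addl.
  case=> -[[a b] ab] [[c d] cd] /= [bc /(congr1 val)].
  rewrite omega_compE //= => -[ap dq] dab dcd.
  have bE : b = p + m by rewrite -ap -dab nsubK.
  by congr pair; apply: val_inj; rewrite /= -?bc ?ap ?bE ?dq.
Defined.

Definition oshift_mor (p : nvec k) (a : omega_mor) : omega_mor :=
  omor (etrans (nle_add2r p (val a).1 (val a).2) (valP a)).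

Definition oshift (p : nvec k) : kfunctor Omega Omega.
Proof.
refine (@KFunctor k Omega Omega (fun n : nvec k => n + p)
  (oshift_mor p) _ _ _ _ _) => //.
- by move=> n; apply: val_inj.
- move=> a b ab; apply: val_inj; rewrite [RHS]omega_compE /= ?omega_compE //.
  by move: ab => /= ->.
- by move=> a; rewrite /= nsub_add2r.
Defined.

End Omega.

Section InfinitePaths.
Variables (k : nat) (L : kgraph k).

Definition infpath : Type := kfunctor (Omega k) L.

HB.instance Definition _ := gen_eqMixin infpath.
HB.instance Definition _ := gen_choiceMixin infpath.

Definition ivertex (x : infpath) (n : nvec k) : kobj L := @fobj k (Omega k) L x n.

Definition irange (x : infpath) : kobj L := ivertex x 0.

Definition iseg (x : infpath) (m n : nvec k) (mn : nle m n) : kmor L :=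
  @fmor k (Omega k) L x (omor mn).

Definition ihead (x : infpath) (n : nvec k) : kmor L := iseg x (nle0 n).

Definition ishift (p : nvec k) (x : infpath) : infpath :=
  kfunctor_comp x (oshift p).

(* [is_prepend l z x] states that [x] is the infinite path [l z], through the
   two conditions that characterize it. *)
Definition is_prepend (l : kmor L) (z x : infpath) : Prop :=
  [/\ irange z = src l, ihead x (deg l) = l & ishift (deg l) x = z].

End InfinitePaths.

Section InfinitePathTheory.
Variables (k : nat) (L : kgraph k).
Implicit Types (x y z : infpath L) (m n p : nvec k).

Lemma factor_inj (a b c d : kmor L) : src a = rng b -> src c = rng d ->
  deg a = deg c -> deg b = deg d -> comp a b = comp c d -> a = c /\ b = d.
Proof.
move=> ab cd dac dbd e.
have [p [_ pU]] := factorization (deg_comp cd).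
have := pU (a, b) (And4 ab e dac dbd).
by rewrite (pU (c, d) (And4 cd erefl erefl erefl)) => -[-> ->].
Qed.

Lemma infpathP x y : (forall m n (mn : nle m n), iseg x mn = iseg y mn) -> x = y.
Proof. by move=> xy; apply: kfunctorP => -[[m n] mn]; exact: xy. Qed.

Lemma iseg_eq x m n m' n' (mn : nle m n) (mn' : nle m' n') :
  m = m' -> n = n' -> iseg x mn = iseg x mn'.
Proof. by move=> e1 e2; subst; congr iseg; apply: bool_irrelevance. Qed.

Lemma rng_iseg x m n (mn : nle m n) : rng (iseg x mn) = ivertex x m.
Proof. exact: fmor_rng. Qed.

Lemma src_iseg x m n (mn : nle m n) : src (iseg x mn) = ivertex x n.
Proof. exact: fmor_src. Qed.

Lemma deg_iseg x m n (mn : nle m n) : deg (iseg x mn) = nsub n m.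
Proof. exact: fmor_deg. Qed.

Lemma rng_ihead x n : rng (ihead x n) = irange x.
Proof. exact: rng_iseg. Qed.

Lemma src_ihead x n : src (ihead x n) = ivertex x n.
Proof. exact: src_iseg. Qed.

Lemma deg_ihead x n : deg (ihead x n) = n.
Proof. by rewrite /ihead deg_iseg -[X in nsub X _]add0r nsub_addl. Qed.

Lemma iseg_comp x m n p (mn : nle m n) (np : nle n p) (mp : nle m p) :
  comp (iseg x mn) (iseg x np) = iseg x mp.
Proof.
rewrite /iseg -(@fmor_comp _ _ _ x) //; congr fmor.
by apply: val_inj; rewrite omega_compE.
Qed.

Lemma iseg_shift x p m n (mn : nle m n) (mn' : nle (m + p) (n + p)) :
  iseg (ishift p x) mn = iseg x mn'.
Proof.
by rewrite /iseg /=; congr (@fmor _ _ _ x); apply: val_inj.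
Qed.

Lemma ivertex_shift x p n : ivertex (ishift p x) n = ivertex x (n + p).
Proof. by []. Qed.

Lemma irange_shift x p : irange (ishift p x) = ivertex x p.
Proof. by rewrite /irange ivertex_shift add0r. Qed.

Lemma ishiftD x m n : ishift m (ishift n x) = ishift (m + n) x.
Proof.
apply: infpathP => p q pq.
have h : nle (p + m) (q + m) by rewrite nle_add2r.
have h' : nle (p + m + n) (q + m + n) by rewrite nle_add2r.
have h2 : nle (p + (m + n)) (q + (m + n)) by rewrite nle_add2r.
by rewrite !iseg_shift (iseg_eq x h' h2) // addrA.
Qed.

Lemma ishift0 x : ishift 0 x = x.
Proof.
apply: infpathP => p q pq.
have h : nle (p + 0) (q + 0) by rewrite nle_add2r.
by rewrite iseg_shift; apply: iseg_eq; rewrite addr0.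
Qed.

Lemma ihead_shift x m n :
  comp (ihead x m) (ihead (ishift m x) n) = ihead x (m + n).
Proof.
have h : nle (0 + m) (n + m) by rewrite nle_add2r nle0.
rewrite /ihead (iseg_shift _ _ h).
have h' : nle m (m + n) by exact: nle_add.
rewrite (iseg_eq x h h') ?add0r 1?addrC //.
exact: iseg_comp.
Qed.

Lemma ihead_inj x y : (forall n, ihead x n = ihead y n) -> x = y.
Proof.
move=> xy; apply: infpathP => m n mn.
have e z : comp (ihead z m) (iseg z mn) = ihead z n by exact: iseg_comp.
have /factor_inj[] // : comp (ihead x m) (iseg x mn) = comp (ihead y m) (iseg y mn).
- by rewrite !e.
- by rewrite src_ihead rng_iseg.
- by rewrite src_ihead rng_iseg.
- by rewrite !deg_ihead.
- by rewrite !deg_iseg.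
Qed.

Lemma ihead_le x y n m : nle m n -> ihead x n = ihead y n ->
  ihead x m = ihead y m.
Proof.
move=> mn xy.
have e z : comp (ihead z m) (iseg z mn) = ihead z n by exact: iseg_comp.
have /factor_inj[] // : comp (ihead x m) (iseg x mn) = comp (ihead y m) (iseg y mn).
- by rewrite !e.
- by rewrite src_ihead rng_iseg.
- by rewrite src_ihead rng_iseg.
- by rewrite !deg_ihead.
- by rewrite !deg_iseg.
Qed.

Lemma infpath_determined x y n :
  ihead x n = ihead y n -> ishift n x = ishift n y -> x = y.
Proof.
move=> h s; apply: ihead_inj => m; apply: (@ihead_le _ _ (n + m)).
  by rewrite addrC nle_add.
by rewrite -!ihead_shift h s.
Qed.

Lemma is_prepend_inj l z x y : is_prepend l z x -> is_prepend l z y -> x = y.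
Proof.
move=> [_ hx sx] [_ hy sy]; apply: (@infpath_determined _ _ (deg l)).
  by rewrite hx hy.
by rewrite sx sy.
Qed.

Lemma is_prepend_ihead x n : is_prepend (ihead x n) (ishift n x) x.
Proof. by split; rewrite ?deg_ihead ?irange_shift ?src_ihead. Qed.

End InfinitePathTheory.

(* A groupoid whose arrows and objects carry a topology; the space [gobj] of
   objects plays the role of the unit space, [gunit] identifying it with the
   set of identity arrows.  As for k-graphs, [gmul g h] is meaningful only when
   [gsrc g = grng h].  The compatibility of the topology with the operations
   plays no part in the definition of the type monoid and is not recorded. *)
Record groupoid := Groupoid {
  gobj : topologicalType;
  garr : topologicalType;
  grng : garr -> gobj;
  gsrc : garr -> gobj;
  gunit : gobj -> garr;
  gmul : garr -> garr -> garr;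
  ginv : garr -> garr;
  grng_unit : forall u, grng (gunit u) = u;
  gsrc_unit : forall u, gsrc (gunit u) = u;
  grng_mul : forall g h, gsrc g = grng h -> grng (gmul g h) = grng g;
  gsrc_mul : forall g h, gsrc g = grng h -> gsrc (gmul g h) = gsrc h;
  gmulA : forall g h l, gsrc g = grng h -> gsrc h = grng l ->
    gmul g (gmul h l) = gmul (gmul g h) l;
  gmul_unitl : forall g, gmul (gunit (grng g)) g = g;
  gmul_unitr : forall g, gmul g (gunit (gsrc g)) = g;
  grng_inv : forall g, grng (ginv g) = gsrc g;
  gsrc_inv : forall g, gsrc (ginv g) = grng g;
  gmul_invl : forall g, gmul (ginv g) g = gunit (gsrc g);
  gmul_invr : forall g, gmul g (ginv g) = gunit (grng g)
}.

Section PathGroupoid.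
Variables (k : nat) (L : kgraph k).

Record parr := PArr {
  prng : infpath L;
  pdeg : zvec k;
  psrc : infpath L;
  parrP : exists n m : nvec k,
    pdeg = zof n - zof m /\ ishift n prng = ishift m psrc
}.

HB.instance Definition _ := gen_eqMixin parr.
HB.instance Definition _ := gen_choiceMixin parr.

Lemma parr_eq (g h : parr) :
  prng g = prng h -> pdeg g = pdeg h -> psrc g = psrc h -> g = h.
Proof.
case: g h => [x n y gP] [x' n' y' hP] /= ex en ey; subst.
by congr PArr; apply: Prop_irrelevance.
Qed.

Definition punit (x : infpath L) : parr.
Proof.
by refine (@PArr x 0 x _); exists 0, 0; rewrite subrr.
Defined.

Definition pinv (g : parr) : parr.
Proof.
refine (@PArr (psrc g) (- pdeg g) (prng g) _).
by have [n [m [-> e]]] := parrP g; exists m, n; rewrite opprB e.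
Defined.

Lemma pmul_subproof (g h : parr) : psrc g = prng h ->
  exists n m : nvec k, pdeg g + pdeg h = zof n - zof m /\
    ishift n (prng g) = ishift m (psrc h).
Proof.
have [n [m [-> e]]] := parrP g; have [n' [m' [-> e']]] := parrP h => gh.
exists (n' + n), (m + m'); split.
  by rewrite !zofD opprD addrACA [zof n' + _]addrC.
by rewrite -!ishiftD -e' e gh !ishiftD addrC.
Qed.

Definition pmul (g h : parr) : parr :=
  match pselect (psrc g = prng h) with
  | left gh => PArr (pmul_subproof gh)
  | right _ => g
  end.

Lemma prng_mul g h : psrc g = prng h -> prng (pmul g h) = prng g.
Proof. by rewrite /pmul; case: pselect. Qed.

Lemma psrc_mul g h : psrc g = prng h -> psrc (pmul g h) = psrc h.
Proof. by rewrite /pmul; case: pselect. Qed.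

Lemma pdeg_mul g h : psrc g = prng h -> pdeg (pmul g h) = pdeg g + pdeg h.
Proof. by rewrite /pmul; case: pselect. Qed.

(* The set Z(l, m) of the arrows (l z, d(l) - d(m), m z). *)
Definition cylinder (l m : kmor L) : set parr :=
  [set g | exists z : infpath L,
    [/\ irange z = src l, is_prepend l z (prng g),
        pdeg g = zof (deg l) - zof (deg m) & is_prepend m z (psrc g)]].

Definition cylinders : set (set parr) :=
  [set U | exists l m, src l = src m /\ U = cylinder l m].

Lemma cylinders_cover : \bigcup_(U in cylinders) id U = setT.
Proof.
apply/seteqP; split=> // g _; have [n [m [e s]]] := parrP g.
exists (cylinder (ihead (prng g) n) (ihead (psrc g) m)).
  exists (ihead (prng g) n), (ihead (psrc g) m); split=> //.
  by rewrite !src_ihead -!irange_shift s.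
exists (ishift n (prng g)); split.
- by rewrite irange_shift src_ihead.
- exact: is_prepend_ihead.
- by rewrite !deg_ihead.
- by rewrite s; exact: is_prepend_ihead.
Qed.

Lemma cylinder_lengthen l m (g h : parr) (a : nvec k) : cylinder l m g ->
  cylinder (ihead (prng g) (deg l + a)) (ihead (psrc g) (deg m + a)) h ->
  cylinder l m h.
Proof.
move=> [z [zl [_ hgl sgl] dg [zm hgm sgm]]] [w [_ [_ hhl shl] dh [_ hhm shm]]].
rewrite !deg_ihead in hhl shl dh hhm shm.
have el : ihead (prng h) (deg l) = l.
  by rewrite -[RHS]hgl; apply: ihead_le hhl; exact: nle_add.
have em : ihead (psrc h) (deg m) = m.
  by rewrite -[RHS]hgm; apply: ihead_le hhm; exact: nle_add.
have hl : ihead (ishift (deg l) (prng h)) a = ihead z a.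
  have := hhl; rewrite -!ihead_shift sgl el hgl => /factor_inj[] //.
  - by rewrite rng_ihead irange_shift -src_ihead el.
  - by rewrite rng_ihead zl.
  - by rewrite !deg_ihead.
have hm : ihead (ishift (deg m) (psrc h)) a = ihead z a.
  have := hhm; rewrite -!ihead_shift sgm em hgm => /factor_inj[] //.
  - by rewrite rng_ihead irange_shift -src_ihead em.
  - by rewrite rng_ihead zm.
  - by rewrite !deg_ihead.
have e : ishift (deg l) (prng h) = ishift (deg m) (psrc h).
  apply: (@infpath_determined _ _ _ _ a); first by rewrite hl hm.
  by rewrite !ishiftD ![a + _]addrC shl shm.
have zlE : irange (ishift (deg l) (prng h)) = src l.
  by rewrite irange_shift -src_ihead el.
exists (ishift (deg l) (prng h)); split=> //.
- by rewrite dh !zofD opprD addrACA subrr addr0.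
- by split=> //; rewrite zlE -zl zm.
Qed.

Lemma cylinders_join (U V : set parr) (g : parr) :
  cylinders U -> cylinders V -> id U g -> id V g ->
  exists W, [/\ cylinders W, id W g & id W `<=` id U `&` id V].
Proof.
move=> [l [m [lm ->]]] [l' [m' [lm' ->]]] gU gV.
have [z [_ [zl hl sl] dg [zm hm sm]]] := gU.
have [z' [_ [zl' hl' sl'] dg' [zm' hm' sm']]] := gV.
pose a : nvec k := nsub (deg l') (deg l).
pose a' : nvec k := nsub (deg l) (deg l').
have eal : deg l + a = deg l' + a'.
  exact: nsub_join.
have eam : deg m + a = deg m' + a'.
  move: dg; rewrite dg' => /eqP.
  rewrite subr_eq addrAC eq_sym subr_eq -!zofD => /eqP/zof_inj e.
  apply: (@nvec_addrI _ (deg l')).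
  by rewrite addrA -e addrAC eal -addrA [a' + _]addrC.
exists (cylinder (ihead (prng g) (deg l + a)) (ihead (psrc g) (deg m + a))).
have zE : ishift (deg l + a) (prng g) = ishift (deg m + a) (psrc g).
  by rewrite ![_ + a]addrC -!ishiftD sl sm.
split.
- exists (ihead (prng g) (deg l + a)), (ihead (psrc g) (deg m + a)); split=> //.
  by rewrite !src_ihead -!irange_shift zE.
- exists (ishift (deg l + a) (prng g)); split.
  + by rewrite irange_shift src_ihead.
  + exact: is_prepend_ihead.
  + by rewrite !deg_ihead !zofD opprD addrACA subrr addr0.
  + by rewrite zE; exact: is_prepend_ihead.
- move=> h hW; split; first exact: cylinder_lengthen hW.
  by apply: (@cylinder_lengthen _ _ _ _ a' gV); rewrite -eal -eam.
Qed.

HB.instance Definition _ :=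
  isBaseTopological.Build parr cylinders_cover cylinders_join.

(* The unit space carries the topology induced by [x |-> (x, 0, x)]. *)
HB.instance Definition _ := Topological.copy (infpath L) (initial_topology punit).

Lemma pmulA g h l : psrc g = prng h -> psrc h = prng l ->
  pmul g (pmul h l) = pmul (pmul g h) l.
Proof.
move=> gh hl.
have ghl : psrc g = prng (pmul h l) by rewrite prng_mul.
have gh_l : psrc (pmul g h) = prng l by rewrite psrc_mul.
apply: parr_eq.
- by rewrite !prng_mul.
- by rewrite !pdeg_mul // addrA.
- by rewrite !psrc_mul.
Qed.

Definition path_groupoid : groupoid.
Proof.
refine (@Groupoid (infpath L) parr prng psrc punit pmul pinv
  _ _ prng_mul psrc_mul pmulA _ _ _ _ _ _) => // g; apply: parr_eq => //=;
  by rewrite ?prng_mul ?psrc_mul ?pdeg_mul //= ?add0r ?addr0 ?addNr ?subrr.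
Defined.

End PathGroupoid.

Section SkewProduct.
Variables (k : nat) (G : groupoid).

Definition cocycle (c : garr G -> zvec k) : Prop :=
  forall g h, gsrc g = grng h -> c (gmul g h) = c g + c h.

Variables (c : garr G -> zvec k) (cM : cocycle c).

Lemma cocycle_unit u : c (gunit u) = 0.
Proof.
have e : gmul (gunit u) (gunit u) = gunit u :> garr G.
  by rewrite -{1}(grng_unit u) gmul_unitl.
have := cM (etrans (gsrc_unit u) (esym (grng_unit u))).
by rewrite e -[X in X = _]addr0 => /addrI.
Qed.

Lemma cocycle_inv g : c (ginv g) = - c g.
Proof.
apply/eqP; rewrite -subr_eq0 opprK -cM ?gsrc_inv // gmul_invl.
exact/eqP/cocycle_unit.
Qed.

Definition skew_groupoid : groupoid.
Proof.
refine (@Groupoid (gobj G * zvec k)%type (garr G * zvec k)%type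
  (fun a => (grng a.1, a.2)) (fun a => (gsrc a.1, a.2 + c a.1))
  (fun u => (gunit u.1, u.2)) (fun a b => (gmul a.1 b.1, a.2))
  (fun a => (ginv a.1, a.2 + c a.1)) _ _ _ _ _ _ _ _ _ _ _) => /=.
- by case=> u al /=; rewrite grng_unit.
- by case=> u al /=; rewrite gsrc_unit cocycle_unit addr0.
- by case=> [g al] [h be] /= [gh _]; rewrite grng_mul.
- by case=> [g al] [h be] /= [gh <-]; rewrite gsrc_mul // cM // addrA.
- by case=> [g al] [h be] [l ga] /= [gh _] [hl _]; rewrite gmulA.
- by case=> g al /=; rewrite gmul_unitl.
- by case=> g al /=; rewrite gmul_unitr.
- by case=> g al /=; rewrite grng_inv.
- by case=> g al /=; rewrite gsrc_inv cocycle_inv addrK.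
- by case=> g al /=; rewrite gmul_invl.
- by case=> g al /=; rewrite gmul_invr.
Defined.

End SkewProduct.

Lemma pdeg_cocycle k (L : kgraph k) : @cocycle k (path_groupoid L) (@pdeg k L).
Proof. by move=> g h; exact: pdeg_mul. Qed.

(* A word [s : seq X] stands for the sum of its letters. *)
Section Presented.
Variables (X : choiceType) (R : seq X -> seq X -> Prop).

Inductive cmon_cong : seq X -> seq X -> Prop :=
| cmon_rel s t : R s t -> cmon_cong s t
| cmon_comm x y : cmon_cong [:: x; y] [:: y; x]
| cmon_refl s : cmon_cong s s
| cmon_sym s t : cmon_cong s t -> cmon_cong t s
| cmon_trans s t u : cmon_cong s t -> cmon_cong t u -> cmon_cong s u
| cmon_cat s t s' t' :
    cmon_cong s t -> cmon_cong s' t' -> cmon_cong (s ++ s') (t ++ t').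

Definition cmon_rel_bool : rel (seq X) := fun s t => `[< cmon_cong s t >].

Lemma cmon_equiv : equiv_class_of cmon_rel_bool.
Proof.
split=> [s|s t|t s u].
- exact/asboolP/cmon_refl.
- by apply/asboolP/asboolP; apply: cmon_sym.
- by move=> /asboolP st /asboolP tu; apply/asboolP; apply: cmon_trans tu.
Qed.

Canonical cmon_equiv_rel := EquivRelPack cmon_equiv.

Definition presented : Type := {eq_quot cmon_equiv_rel}.

HB.instance Definition _ := Choice.on presented.

Definition pclass (s : seq X) : presented := \pi_({eq_quot cmon_equiv_rel}) s.

Definition pgen (x : X) : presented := pclass [:: x].

Lemma pclassP s t : pclass s = pclass t <-> cmon_cong s t.
Proof. by split=> [/eqquotP/asboolP|st]; last exact/eqquotP/asboolP. Qed.

Lemma pclass_repr (u : presented) : pclass (repr u) = u.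
Proof. exact: reprK. Qed.

Lemma cmon_cong_repr s : cmon_cong (repr (pclass s)) s.
Proof. by apply/pclassP; exact: pclass_repr. Qed.

Definition padd (u v : presented) : presented := pclass (repr u ++ repr v).

Lemma pclass_cat s t : pclass (s ++ t) = padd (pclass s) (pclass t).
Proof. by apply/pclassP/cmon_cat; apply/cmon_sym/cmon_cong_repr. Qed.

Lemma cmon_catC s t : cmon_cong (s ++ t) (t ++ s).
Proof.
have cons1 x u : cmon_cong (x :: u) (u ++ [:: x]).
  elim: u => [|y u IHu]; first exact: cmon_refl.
  apply: cmon_trans (cmon_cat (cmon_refl [:: y]) IHu).
  exact: cmon_cat (cmon_comm x y) (cmon_refl u).
elim: s => [|x s IHs] /=; first by rewrite cats0; exact: cmon_refl.
apply: cmon_trans (cmon_cat (cmon_refl [:: x]) IHs) _.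
rewrite /= -cat_cons -[x :: s]cat1s catA.
exact: cmon_cat (cons1 x t) (cmon_refl s).
Qed.

Lemma paddA : associative padd.
Proof.
move=> u v w.
by rewrite -(pclass_repr u) -(pclass_repr v) -(pclass_repr w) -!pclass_cat catA.
Qed.

Lemma paddC : commutative padd.
Proof.
move=> u v; rewrite -(pclass_repr u) -(pclass_repr v) -!pclass_cat.
exact/pclassP/cmon_catC.
Qed.

Lemma padd0 : left_id (pclass [::]) padd.
Proof. by move=> u; rewrite -(pclass_repr u) -pclass_cat. Qed.

HB.instance Definition _ := GRing.isNmodule.Build presented paddA paddC padd0.

Lemma pclass0 : pclass [::] = 0.
Proof. by []. Qed.

Lemma pclassD s t : pclass (s ++ t) = pclass s + pclass t.
Proof. exact: pclass_cat. Qed.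

Lemma pclassE s : pclass s = \sum_(x <- s) pgen x.
Proof.
by elim: s => [|x s IHs]; rewrite ?big_nil // big_cons -IHs -pclassD.
Qed.

End Presented.

(* [pmap_word R S f] is defined through chosen representatives; it is the
   homomorphism extending [f] once [f] sends the relations [R] to consequences
   of the relations [S]. *)
Section PresentedMap.
Variables (X Y : choiceType).
Variables (R : seq X -> seq X -> Prop) (S : seq Y -> seq Y -> Prop) (f : X -> Y).

Definition pmap_word (u : presented R) : presented S := pclass S (map f (repr u)).

Hypothesis fR : forall s t, R s t -> cmon_cong S (map f s) (map f t).

Lemma cmon_cong_map s t : cmon_cong R s t -> cmon_cong S (map f s) (map f t).
Proof.
elim=> {s t} [s t|x y|s|s t _|s t u _ st _|s t s' t' _ st _].
- exact: fR.
- exact: cmon_comm.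
- exact: cmon_refl.
- exact: cmon_sym.
- exact: cmon_trans.
- by rewrite !map_cat; exact: cmon_cat.
Qed.

Lemma pmap_wordE s : pmap_word (pclass R s) = pclass S (map f s).
Proof. by apply/pclassP/cmon_cong_map/cmon_cong_repr. Qed.

Lemma pmap_word0 : pmap_word 0 = 0.
Proof. exact: (pmap_wordE [::]). Qed.

Lemma pmap_wordD u v : pmap_word (u + v) = pmap_word u + pmap_word v.
Proof.
rewrite -(pclass_repr u) -(pclass_repr v) -pclassD !pmap_wordE map_cat.
exact: pclassD.
Qed.

End PresentedMap.

HB.mixin Record isZkMonoid (k : nat) M of GRing.Nmodule M := {
  zact : zvec k -> M -> M;
  zact0 : forall x, zact 0 x = x;
  zactA : forall m n x, zact (m + n) x = zact m (zact n x);
  zact_zero : forall n, zact n 0 = 0;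
  zact_add : forall n x y, zact n (x + y) = zact n x + zact n y
}.

#[short(type="zkMonoidType")]
HB.structure Definition ZkMonoid (k : nat) :=
  {M of GRing.Nmodule M & isZkMonoid k M}.

Definition zk_isomorphic k (M N : zkMonoidType k) : Prop :=
  exists f : {additive M -> N},
    bijective f /\ forall (n : zvec k) x, f (zact n x) = zact n (f x).

Definition conical (M : nmodType) : Prop :=
  forall x y : M, x + y = 0 -> x = 0 /\ y = 0.

Definition refinement_monoid (M : nmodType) : Prop :=
  forall a b c d : M, a + b = c + d ->
    exists z1 z2 z3 z4 : M,
      [/\ a = z1 + z2, b = z3 + z4, c = z1 + z3 & d = z2 + z4].

Section TalentedMonoid.
Variables (k : nat) (L : kgraph k).

(* The generator [v(n)] is the pair [(v, n)], and [e] enumerates the finite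
   nonempty set [v L^{e_i}]. *)
Inductive talented_rel :
    seq (kobj L * zvec k) -> seq (kobj L * zvec k) -> Prop :=
| TalentedRel (v : kobj L) (n : zvec k) (i : 'I_k) (e : seq (kmor L)) :
    uniq e -> [set` e] = vpaths v (nbasis i) -> e != [::] ->
    talented_rel [:: (v, n)] [seq (src a, n + zof (nbasis i)) | a <- e].

Definition talented : Type := presented talented_rel.

HB.instance Definition _ := GRing.Nmodule.on talented.

Definition tvertex (v : kobj L) (n : zvec k) : talented := pgen talented_rel (v, n).

Definition tshift (n : zvec k) (g : kobj L * zvec k) : kobj L * zvec k :=
  (g.1, g.2 + n).

Definition tact (n : zvec k) : talented -> talented :=
  pmap_word talented_rel (tshift n).

Lemma tshift_rel n s t : talented_rel s t ->
  cmon_cong talented_rel (map (tshift n) s) (map (tshift n) t).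
Proof.
case=> v m i e eU eE e0; apply: cmon_rel; rewrite -map_comp /=.
rewrite (_ : map _ e = [seq (src a, (m + n) + zof (nbasis i)) | a <- e]) //.
by apply: eq_map => a; rewrite /tshift /= addrAC.
Qed.

Lemma tact0 x : tact 0 x = x.
Proof.
rewrite -(pclass_repr x) [LHS](pmap_wordE (@tshift_rel 0)) map_id_in //.
by move=> [v m] _; rewrite /tshift /= addr0.
Qed.

Lemma tactA m n x : tact (m + n) x = tact m (tact n x).
Proof.
rewrite -(pclass_repr x) /tact !pmap_wordE; do ?exact: tshift_rel.
rewrite -map_comp; congr pclass; apply: eq_map => -[v p].
by rewrite /tshift /= addrAC addrA.
Qed.

HB.instance Definition _ := isZkMonoid.Build k talented tact0 tactA
  (fun n => pmap_word0 (@tshift_rel n)) (fun n => pmap_wordD (@tshift_rel n)).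

Lemma zact_tvertex n v m : zact n (tvertex v m) = tvertex v (m + n).
Proof. exact: (pmap_wordE (@tshift_rel n)). Qed.

End TalentedMonoid.

Definition compact_open (T : topologicalType) : set (set T) :=
  [set U | compact U /\ open U].

Section TypeMonoid.
Variable G : groupoid.

(* For the open sets [B] below in an ample (hence etale) groupoid, injectivity
   of the two maps makes them homeomorphisms onto open sets. *)
Definition bisection (B : set (garr G)) : Prop :=
  set_inj B (@grng G) /\ set_inj B (@gsrc G).

Definition copen : choiceType := set_type (@compact_open (gobj G)).

Inductive typ_rel : seq copen -> seq copen -> Prop :=
| TypEmpty (U : copen) : val U = set0 -> typ_rel [:: U] [::]
| TypBisection (B : set (garr G)) (U V : copen) :
    compact_open B -> bisection B ->
    val U = @gsrc G @` B -> val V = @grng G @` B -> typ_rel [:: U] [:: V]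
| TypUnion (U V W : copen) : val U `&` val V = set0 ->
    val W = val U `|` val V -> typ_rel [:: W] [:: U; V].

Definition typ_monoid : Type := presented typ_rel.

HB.instance Definition _ := GRing.Nmodule.on typ_monoid.

Definition typ (U : copen) : typ_monoid := pgen typ_rel U.

End TypeMonoid.

Section GradedTypeMonoid.
Variables (k : nat) (G : groupoid) (c : garr G -> zvec k) (cM : cocycle c).

Local Notation SG := (skew_groupoid cM).

Definition groupoid_talented : Type := typ_monoid SG.

HB.instance Definition _ := GRing.Nmodule.on groupoid_talented.

Definition translate (T : Type) (n : zvec k) (p : T * zvec k) : T * zvec k :=
  (p.1, n + p.2).

Lemma translateK T n : cancel (@translate T n) (translate (- n)).
Proof. by case=> x m; rewrite /translate /= addKr. Qed.

Lemma translateNK T n : cancel (translate (- n)) (@translate T n).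
Proof. by case=> x m; rewrite /translate /= addNKr. Qed.

Lemma translate_image T n (U : set (T * zvec k)) :
  translate n @` U = translate (- n) @^-1` U.
Proof.
apply/seteqP; split=> [_ [p Up <-]|p Up]; first by rewrite /preimage /= translateK.
by exists (translate (- n) p); rewrite ?translateNK.
Qed.

Lemma translate_continuous (T : topologicalType) n :
  continuous (@translate T n : T * zvec k -> T * zvec k).
Proof.
move=> [x m]; apply: (@cvg_pair _ _ _ (nbhs (x, m)) (nbhs x) (nbhs (n + m))).
  exact: cvg_fst.
apply: (@cvg_comp _ _ _ snd (+%R n) _ (nbhs m)); first exact: cvg_snd.
move=> A /nbhs_singleton /= nmA; rewrite /= nbhs_simpl.
by apply: open_nbhs_nbhs; split=> //; exact: discrete_open.
Qed.

Lemma compact_open_translate (T : topologicalType) n (U : set (T * zvec k)) :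
  compact_open U -> compact_open (translate n @` U).
Proof.
move=> [cU oU]; split.
  by apply: continuous_compact cU; apply/continuous_subspaceT/translate_continuous.
rewrite translate_image; apply: open_comp oU => p _.
exact: translate_continuous.
Qed.

Definition copen_translate (n : zvec k) (U : copen SG) : copen SG :=
  exist _ (translate n @` val U)
    (mem_set (compact_open_translate n (set_mem (valP U)))).

Lemma typ_rel_translate n s t : @typ_rel SG s t ->
  cmon_cong (@typ_rel SG) (map (copen_translate n) s) (map (copen_translate n) t).
Proof.
case=> [U U0|B U V cB [rB sB] UE VE|U V W UV WE] /=; apply: cmon_rel.
- by apply: TypEmpty; rewrite /= U0 image_set0.
- apply: (@TypBisection SG (translate n @` B)).
  + exact: compact_open_translate.
  + split=> a b /set_mem[a' Ba' <-] /set_mem[b' Bb' <-] /= [].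
      move=> e1 /addrI e2; congr translate.
      by apply: rB; rewrite ?inE //= e1 e2.
    move=> e1; rewrite -!addrA => /addrI e2; congr translate.
    by apply: sB; rewrite ?inE //= e1 e2.
  + rewrite /= UE !image_comp; apply: eq_imagel => a _.
    by rewrite /translate /= addrA.
  + by rewrite /= VE !image_comp.
- apply: TypUnion; rewrite /=; last by rewrite WE image_setU.
  by rewrite !translate_image -preimage_setI UV preimage_set0.
Qed.

(* The action moves [U] to [{(x, n + m) | (x, m) in U}], which on the sets
   [U `*` [set m]] is the formula given by [zact_typ_setX]. *)
Definition gact (n : zvec k) : groupoid_talented -> groupoid_talented :=
  pmap_word (@typ_rel SG) (copen_translate n).

Lemma gact0 x : gact 0 x = x.
Proof.
rewrite -(pclass_repr x) [LHS](pmap_wordE (@typ_rel_translate 0)) map_id_in //.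
move=> U _; apply: val_inj; rewrite /= -[RHS]image_id.
by apply: eq_imagel => -[y m] _; rewrite /translate /= add0r.
Qed.

Lemma gactA m n x : gact (m + n) x = gact m (gact n x).
Proof.
rewrite -(pclass_repr x) /gact !pmap_wordE; do ?exact: typ_rel_translate.
rewrite -map_comp; congr pclass; apply: eq_map => U; apply: val_inj.
rewrite /= image_comp; apply: eq_imagel => -[y p] _.
by rewrite /translate /= addrA.
Qed.

HB.instance Definition _ := isZkMonoid.Build k groupoid_talented gact0 gactA
  (fun n => pmap_word0 (@typ_rel_translate n))
  (fun n => pmap_wordD (@typ_rel_translate n)).

Lemma compact_open_setX (U : set (gobj G)) (m : zvec k) :
  compact_open U -> compact_open (U `*` [set m]).
Proof.
move=> [cU oU]; split; first exact: compact_setX cU (@compact_set1 _ m).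
apply: (@openI _ (fst @^-1` U) (snd @^-1` [set m])).
  by apply: open_comp oU => p _; exact: cvg_fst.
by apply: open_comp (discrete_open [set m]) => p _; exact: cvg_snd.
Qed.

Definition typX (U : copen G) (m : zvec k) : groupoid_talented :=
  typ (exist _ (val U `*` [set m])
    (mem_set (compact_open_setX m (set_mem (valP U)))) : copen SG).

Lemma zact_typ_setX n (U : copen G) m : zact n (typX U m) = typX U (n + m).
Proof.
rewrite [LHS](pmap_wordE (@typ_rel_translate n)); congr (pclass _ [:: _]).
apply: val_inj => /=; apply/seteqP; split=> [_ [[x p] [/= Ux ->] <-]|[x p]] //=.
by move=> [Ux ->]; exists (x, m).
Qed.

End GradedTypeMonoid.

(* Main.v *)
From HB Require Import structures.
From mathcomp Require Import all_boot all_algebra.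
From mathcomp Require Import finmap boolp classical_sets cardinality.
From mathcomp Require Import filter topology.
From mathcomp Require Import zify.
Require Import Defs.

(** The talented monoid is a direct limit of free commutative monoids.  Every
generator [v(n)] lying below the level [N = (N, ..., N)] equals the sum of the
[s(a)(N)] over the paths [a] from [v] of degree [N - n] ([tvertex_sum]), and two
words are congruent exactly when, once pushed to a high enough level in this
way, they agree up to reordering ([push_word_cong], [pclass_push_word]).  Since a nonempty word is
pushed to a nonempty word, the monoid is conical; since free commutative monoids
have refinement ([perm_cat_refine]), it has refinement.  The groupoid plays no
part in this half.

The isomorphism sends [v(n)] to the type of the box [Z(v) x {n}].  This respects
the relations because [Z(v)] is the disjoint union of the [Z(a)], with [a] of
degree [e_i], and because the bisection [Z(a, s(a)) x {n}] identifies the type of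
[Z(a) x {n}] with that of [Z(s(a)) x {n + d(a)}] ([typ_box_src]).  The sets
involved are compact by row-finiteness ([compact_vcyl]): an ultrafilter on
[Z(l)] selects one prefix in each of a cofinal family of degrees, and the
selected prefixes are those of its limit.  For that one must build infinite paths from chains of morphisms
([path_of_chain]).

For the inverse, a compact open set [U] of the unit space of the skew product is
cut at a level [N]: each [(x, n)] in [U] has the prefix [l] of [x] of degree
[N - n].  When [N] is high enough, [U] is the disjoint union of the finitely many
boxes [Z(l) x {n}] so obtained, and the value of [U] is the sum of the
[s(l)(N)] ([cut_sum]).  It does not depend on [N] ([cut_sum_leq]; here the
absence of sources ensures that no box is empty) and it is additive.  If [U] and
[V] are the source and the range of a compact open bisection [B], then for [N]
high enough cutting both ends of the arrows of [B] gives a bijection between the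
boxes of [U] and those of [V] which preserves the vertices [s(l)]
([value_bisection]).  Hence the value descends to the type monoid, where it is
inverse to the map above by the decomposition into boxes ([typ_cut]) and by the
formula for [v(n)] at level [N] ([value_box]). *)

Set Implicit Arguments.
Unset Strict Implicit.
Unset Printing Implicit Defensive.

Import GRing.Theory.

Local Open Scope classical_set_scope.
Local Open Scope ring_scope.

(** * Prefixes of morphisms *)

Section Prefixes.
Variables (k : nat) (L : kgraph k).
Implicit Types (a b c l : kmor L) (m n : nvec k).

(** [a] is an initial segment of [l], that is [l = a b] for some [b]. *)
Definition is_prefix a l : Prop := exists2 b, src a = rng b & l = comp a b.

Lemma is_prefix_refl a : is_prefix a a.
Proof. by exists (idm (src a)); rewrite ?rng_id ?comp_idr. Qed.

Lemma is_prefix_trans b a l : is_prefix a b -> is_prefix b l -> is_prefix a l.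
Proof.
move=> [c ac ->] [d cd ->]; rewrite src_comp // in cd.
by exists (comp c d); rewrite ?rng_comp ?compA.
Qed.

Lemma is_prefix_exists l m : nle m (deg l) ->
  exists2 a, is_prefix a l & deg a = m.
Proof.
move=> ml; have [[a b] [[/= ab e da _] _]] := factorization (esym (nsubK ml)).
by exists a => //; exists b.
Qed.

Lemma is_prefix_inj a b l : is_prefix a l -> is_prefix b l -> deg a = deg b ->
  a = b.
Proof.
move=> [a' aa' e] [b' bb' e'] dab.
have /factor_inj[] // : comp a a' = comp b b' by rewrite -e.
by apply: (@nvec_addrI _ (deg a)); rewrite [in RHS]dab -!deg_comp // -e -e'.
Qed.

Lemma is_prefix_comparable a b l : is_prefix a l -> is_prefix b l ->
  nle (deg a) (deg b) -> is_prefix a b.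
Proof.
move=> al bl /is_prefix_exists[c cb dc].
by rewrite (is_prefix_inj al (is_prefix_trans cb bl)).
Qed.

Lemma is_prefix_comp a b c : src a = rng b -> is_prefix b c ->
  is_prefix (comp a b) (comp a c).
Proof.
move=> ab [d bd ->]; exists d; first by rewrite src_comp.
by rewrite compA.
Qed.

Lemma is_prefix_iheads (x : infpath L) m n : nle m n ->
  is_prefix (ihead x m) (ihead x n).
Proof.
move=> mn; exists (iseg x mn); first by rewrite src_ihead rng_iseg.
by symmetry; exact: iseg_comp.
Qed.

End Prefixes.

(** * Infinite paths *)

Section PathOfHeads.
Variables (k : nat) (L : kgraph k) (h : nvec k -> kmor L).
Hypothesis dh : forall n, deg (h n) = n.
Hypothesis hh : forall m n, nle m n -> is_prefix (h m) (h n).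

(* [seg (m, n)] is the complement of [h m] in [h n], hence the segment from [m]
   to [n] of the path to be built. *)
Let seg (a : omega_mor k) : kmor L := sval (cid2 (hh (valP a))).

Let src_h a : src (h (val a).1) = rng (seg a).
Proof. by rewrite /seg; case: cid2. Qed.

Let seg_comp a : h (val a).2 = comp (h (val a).1) (seg a).
Proof. by rewrite /seg; case: cid2. Qed.

Let deg_seg a : deg (seg a) = nsub (val a).2 (val a).1.
Proof.
apply: (@nvec_addrI _ (val a).1); rewrite -{1}(dh (val a).1) -deg_comp ?src_h //.
by rewrite -seg_comp dh nsubK //; exact: (valP a).
Qed.

Let seg_src a : src (seg a) = src (h (val a).2).
Proof. by rewrite seg_comp src_comp. Qed.

Let path_of_heads : infpath L.
Proof.
refine (@KFunctor k (Omega k) L (fun n => src (h n)) seg _ _ _ _ _) => //.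
- by move=> a; rewrite -src_h.
- move=> n /=; have /factor_inj[] // :
      comp (h n) (seg (omor (nle_refl n))) = comp (h n) (idm (src (h n))).
  + by rewrite comp_idr; symmetry; exact: (seg_comp (omor (nle_refl n))).
  + exact: (src_h (omor (nle_refl n))).
  + by rewrite rng_id.
  + by rewrite deg_seg /= nsubnn deg_id.
- move=> a b ab; rewrite /= in ab.
  have sab : src (seg a) = rng (seg b) by rewrite seg_src ab src_h.
  have abE : val (omega_comp a b) = ((val a).1, (val b).2) by exact: omega_compE.
  have /factor_inj[] // : comp (h (val a).1) (seg (omega_comp a b)) =
      comp (h (val a).1) (comp (seg a) (seg b)).
  + have := seg_comp (omega_comp a b); rewrite abE /= => <-.
    by rewrite compA ?src_h // -seg_comp ab -seg_comp.
  + by have := src_h (omega_comp a b); rewrite abE.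
  + by rewrite rng_comp // src_h.
  + rewrite deg_comp // !deg_seg abE /= -ab; apply: nsub_trans.
      exact: (valP a).
    by rewrite ab; exact: (valP b).
Defined.

(** A family of morphisms [h n] of degree [n], each a prefix of the later ones,
is the family of initial segments of an infinite path. *)
Lemma path_of_heads_exists : exists x : infpath L, forall n, ihead x n = h n.
Proof.
exists path_of_heads => n; rewrite /ihead /iseg /=.
have d0 : deg (h 0) = 0 by exact: dh.
have [b hb e] := hh (nle0 n).
have h0 : h 0 = idm (rng (h n)).
  apply: (@is_prefix_inj _ _ _ _ (h n)) => //; first exact: hh (nle0 n).
    by exists (h n); rewrite ?src_id ?comp_idl.
  by rewrite d0 deg_id.
have := seg_comp (omor (nle0 n)); rewrite /= => e1.
have sE : rng (seg (omor (nle0 n))) = rng (h n).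
  by rewrite -src_h /= h0 src_id.
by rewrite [RHS]e1 h0 -sE comp_idl.
Qed.

End PathOfHeads.

Section PathConstruction.
Variables (k : nat) (L : kgraph k).
Implicit Types (x y z : infpath L) (l : kmor L) (m n : nvec k).

(** The diagonal degree [(N, ..., N)]; these degrees are cofinal in [N^k], so it
is enough to use levels indexed by the natural numbers. *)
Definition ncst (N : nat) : nvec k := [ffun=> N].

Lemma ncstE N i : ncst N i = N. Proof. by rewrite ffunE. Qed.

Lemma nle_ncst M N : (M <= N)%N -> nle (ncst M) (ncst N).
Proof. by move=> MN; apply/nleP => i; rewrite !ncstE. Qed.

(** The largest coordinate of [n]. *)
Definition nmax n : nat := \max_i n i.

Lemma nle_nmax n : nle n (ncst (nmax n)).
Proof. by apply/nleP => i; rewrite ncstE; apply: leq_bigmax. Qed.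

Lemma nle_nmax_le n N : (nmax n <= N)%N -> nle n (ncst N).
Proof. by move=> /nle_ncst; apply: nle_trans (nle_nmax n). Qed.

Lemma leq_nmax m n : nle m n -> (nmax m <= nmax n)%N.
Proof.
move=> /nleP mn; apply/bigmax_leqP => i _; apply: leq_trans (mn i) _.
exact: leq_bigmax.
Qed.

(** The degrees of a chain need not be exactly diagonal: they need only dominate
the diagonal ones.  This covers the path [l z], a path with a given range, and
the limit of an ultrafilter on [Z(l)]. *)
Lemma path_of_chain (g : nat -> kmor L) :
    (forall N, nle (ncst N) (deg (g N))) ->
    (forall N, is_prefix (g N) (g N.+1)) ->
  exists x : infpath L, forall N, ihead x (deg (g N)) = g N.
Proof.
move=> dg gg.
have ggle M N : (M <= N)%N -> is_prefix (g M) (g N).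
  move=> /subnK <-; elim: (N - M)%N => [|j IHj]; first exact: is_prefix_refl.
  by rewrite addSn; apply: is_prefix_trans IHj (gg _).
have ndg n N : (nmax n <= N)%N -> nle n (deg (g N)).
  by move=> /nle_nmax_le nN; apply: nle_trans (dg N).
pose h n := s2val (cid2 (is_prefix_exists (ndg n _ (leqnn _)))).
have hg n : is_prefix (h n) (g (nmax n)) by rewrite /h; case: cid2.
have dh n : deg (h n) = n by rewrite /h; case: cid2.
have hg' n N : (nmax n <= N)%N -> is_prefix (h n) (g N).
  by move=> nN; apply: is_prefix_trans (hg n) (ggle _ _ nN).
have hh m n : nle m n -> is_prefix (h m) (h n).
  move=> mn; apply: is_prefix_comparable (hg n) _; rewrite ?dh //.
  exact/hg'/leq_nmax.
have [x xh] := path_of_heads_exists dh hh.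
exists x => N; rewrite xh.
pose M := maxn N (nmax (deg (g N))).
apply: (@is_prefix_inj _ _ _ _ (g M)); rewrite ?dh //.
  by apply: hg'; rewrite leq_maxr.
by apply: ggle; rewrite leq_maxl.
Qed.

Lemma prepend_exists l z : irange z = src l -> exists x, is_prepend l z x.
Proof.
move=> zl; have lz n : src l = rng (ihead z n) by rewrite rng_ihead.
pose g N := comp l (ihead z (ncst N)).
have dg N : deg (g N) = deg l + ncst N by rewrite deg_comp // deg_ihead.
have [|N|x xg] := @path_of_chain g.
- by move=> N; rewrite dg addrC nle_add.
- apply: is_prefix_comp => //; apply: is_prefix_iheads; exact: nle_ncst.
have xl : ihead x (deg l) = l.
  apply: (@is_prefix_inj _ _ _ _ (g 0%N)); rewrite ?deg_ihead //.
    by rewrite -xg; apply: is_prefix_iheads; rewrite dg nle_add.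
  by exists (ihead z (ncst 0)).
exists x; split=> //; apply: ihead_inj => n.
apply: (@ihead_le _ _ _ _ (ncst (nmax n))); first exact: nle_nmax.
have := xg (nmax n); rewrite dg -ihead_shift xl => /factor_inj[] //.
  by rewrite rng_ihead irange_shift -src_ihead xl.
by rewrite !deg_ihead.
Qed.

Lemma infpath_exists (Lns : no_sources L) (v : kobj L) :
  exists x : infpath L, irange x = v.
Proof.
have ext (l : kmor L) : exists l', is_prefix l l' /\ deg l' = deg l + ncst 1.
  have [a [la da]] := Lns (src l) (ncst 1).
  by exists (comp l a); rewrite deg_comp // da; split=> //; exists a.
pose f l := sval (cid (ext l)).
have fl l : is_prefix l (f l) by rewrite /f; case: cid => ? [].
have df l : deg (f l) = deg l + ncst 1 by rewrite /f; case: cid => ? [].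
have dg N : deg (iter N f (idm v)) = ncst N.
  elim: N => [|N IHN] /=.
    by rewrite deg_id; apply/ffunP => i; rewrite !ffunE.
  by rewrite df IHN; apply/ffunP => i; rewrite nvecD !ncstE addn1.
have [N|N|x xg] := @path_of_chain (fun N => iter N f (idm v)).
- by rewrite dg nle_refl.
- exact: fl.
exists x; have := xg 0%N; rewrite /= => /(congr1 (@rng _ _)).
by rewrite rng_ihead rng_id.
Qed.

Lemma infpath_through (Lns : no_sources L) l :
  exists x : infpath L, ihead x (deg l) = l.
Proof.
have [z zl] := infpath_exists Lns (src l).
by have [x [_ xl _]] := prepend_exists zl; exists x.
Qed.

End PathConstruction.

(** * Levels *)

Section Levels.
Variable k : nat.
Implicit Types (n : zvec k) (m p : nvec k) (M N : nat).

(** The level [(N, ..., N)] of [Z^k]. *)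
Definition zcst N : zvec k := zof (ncst k N).

(** [n] is coordinatewise at most [N]. *)
Definition below N n : Prop := exists m, n + zof m = zcst N.

(** The difference [N - n], as a vector of natural numbers; it is the zero
vector, without meaning, when [n] is not below [N]. *)
Definition gap N n : nvec k := xget 0 [set m | n + zof m = zcst N].

Lemma gapK N n : below N n -> n + zof (gap N n) = zcst N.
Proof. exact: (@xgetPex _ 0 [set m | n + zof m = zcst N]). Qed.

Lemma gap_eq N n m : n + zof m = zcst N -> gap N n = m.
Proof.
move=> e; apply: zof_inj; apply: (addrI n); rewrite e gapK //.
by exists m.
Qed.

Lemma zcstD N M : zcst (N + M) = zcst N + zof (ncst k M).
Proof.
by rewrite /zcst -zofD; congr zof; apply/ffunP => i; rewrite nvecD !ncstE.
Qed.

Lemma gap_addr N n m : below N (n + zof m) -> gap N n = m + gap N (n + zof m).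
Proof. by move=> nN; apply: gap_eq; rewrite zofD addrA gapK. Qed.

Lemma below_leq N M n : (N <= M)%N -> below N n -> below M n.
Proof.
move=> /subnKC <- [m e]; exists (m + ncst k (M - N)).
by rewrite zofD addrA e zcstD.
Qed.

Lemma gap_leq N M n : (N <= M)%N -> below N n ->
  gap M n = gap N n + ncst k (M - N).
Proof.
by move=> NM nN; apply: gap_eq; rewrite zofD addrA gapK // -zcstD subnKC.
Qed.

Lemma below_near n : exists N0, forall N, (N0 <= N)%N -> below N n.
Proof.
suff [N nN] : exists N, below N n.
  by exists N => M NM; apply: below_leq nN.
pose f : {ffun 'I_k -> int} := n; exists (\max_i `|f i|)%N.
exists [ffun i => `|(\max_i `|f i|)%N%:Z - f i|%N].
apply/ffunP => i; rewrite !ffunE -/f.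
have : (`|f i| <= \max_i `|f i|)%N by exact: (@leq_bigmax _ (fun i => `|f i|%N)).
by rewrite /=; lia.
Qed.

End Levels.

Lemma nvec_eq0_or k (m : nvec k) : m = 0 \/ exists i, (0 < m i)%N.
Proof.
case: (pselect (exists i, (0 < m i)%N)) => [|nm]; [by right|left].
apply/ffunP => i; rewrite ffunE; apply/eqP; rewrite -leqn0 leqNgt.
by apply/negP => mi; apply: nm; exists i.
Qed.

Lemma nvec_ind k (P : nvec k -> Prop) :
  P 0 -> (forall m i, P m -> P (m + nbasis i)) -> forall m, P m.
Proof.
move=> P0 PS m; move: {2}(\sum_i m i)%N (leqnn (\sum_i m i)) => s.
elim: s m => [|s IHs] m ms;
  have [->//|[i mi]] : m = 0 \/ exists i, (0 < m i)%N by exact: nvec_eq0_or.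
- by move: ms; rewrite (bigD1 i) //= leqn0 addn_eq0 -[_ == 0%N]negbK -lt0n mi.
- have im : nle (nbasis i) m.
    by apply/nleP => j; rewrite ffunE; case: eqP => [->|].
  rewrite -(nsubK im) addrC; apply/PS/IHs; rewrite -ltnS; apply: leq_trans ms.
  rewrite (bigD1 i) //= [X in (_ < X)%N](bigD1 i) //= nsubE ffunE eqxx.
  rewrite -addSn -subSn // subn1 /= leq_add2l; apply: leq_sum => j _.
  by rewrite nsubE leq_subr.
Qed.

(** * Finite multisets *)

(** The refinement property of free commutative monoids, for words up to
reordering. *)
Lemma perm_cat_refine (T : eqType) (a b c d : seq T) :
  perm_eq (a ++ b) (c ++ d) -> exists z1 z2 z3 z4,
    [/\ perm_eq a (z1 ++ z2), perm_eq b (z3 ++ z4),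
        perm_eq c (z1 ++ z3) & perm_eq d (z2 ++ z4)].
Proof.
elim: a c d => [|x a IHa] c d; first by exists [::], [::], c, d; split.
move=> abcd; have := perm_mem abcd x.
rewrite mem_head mem_cat => /esym/orP[xc|xd].
- have [|z1 [z2 [z3 [z4 [az bz cz dz]]]]] := IHa (rem x c) d.
    rewrite -(perm_cons x); apply: perm_trans abcd _.
    exact: (perm_cat (perm_to_rem xc)).
  exists (x :: z1), z2, z3, z4; split; rewrite /= ?perm_cons //.
  by apply: perm_trans (perm_to_rem xc) _; rewrite perm_cons.
- have [|z1 [z2 [z3 [z4 [az bz cz dz]]]]] := IHa c (rem x d).
    rewrite -(perm_cons x); apply: perm_trans abcd _.
    rewrite perm_sym -cat1s perm_catCA perm_cat2l perm_sym.
    exact: perm_to_rem.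
  exists z1, (x :: z2), z3, z4; split; rewrite /= ?perm_cons //.
    by rewrite perm_sym -cat1s perm_catCA /= perm_cons perm_sym.
  by apply: perm_trans (perm_to_rem xd) _; rewrite perm_cons.
Qed.

(** * The talented monoid as a direct limit of free monoids *)

Section VertexPaths.
Variables (k : nat) (L : kgraph k).
Hypothesis Lfin : row_finite L.
Implicit Types (v : kobj L) (m n : nvec k) (a : kmor L).

(** The elements of [v L^m], listed without repetition; the list is empty when
[v L^m] is infinite. *)
Definition enum_vpaths v m : seq (kmor L) := enum_fset (fset_set (vpaths v m)).

Lemma enum_vpaths_uniq v m : uniq (enum_vpaths v m).
Proof. exact: fset_uniq. Qed.

Lemma mem_enum_vpaths v m a : a \in enum_vpaths v m <-> rng a = v /\ deg a = m.
Proof.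
have := in_fset_set (Lfin v m) a; rewrite /enum_vpaths /= => ->.
by rewrite inE.
Qed.

Lemma enum_vpathsD v m n : perm_eq (enum_vpaths v (m + n))
  [seq comp a b | a <- enum_vpaths v m, b <- enum_vpaths (src a) n].
Proof.
apply: uniq_perm; first exact: enum_vpaths_uniq.
  apply: allpairs_uniq_dep; first exact: enum_vpaths_uniq.
    by move=> a _; exact: enum_vpaths_uniq.
  move=> x y /allpairsPdep[a [b [/mem_enum_vpaths[_ da] /mem_enum_vpaths[rb db] ->]]].
  move=> /allpairsPdep[c [d [/mem_enum_vpaths[_ dc] /mem_enum_vpaths[rd dd] ->]]] /=.
  move=> /factor_inj[] //; rewrite ?da ?db // => ac bd.
  by rewrite ac bd.
move=> l; apply/idP/idP => [/mem_enum_vpaths[rl dl]|].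
  have [[a b] [[/= ab e da db] _]] := factorization dl.
  apply/allpairsPdep; exists a, b; split; last by rewrite e.
    by apply/mem_enum_vpaths; rewrite -rl -e rng_comp.
  by apply/mem_enum_vpaths.
move=> /allpairsPdep[a [b [/mem_enum_vpaths[ra da] /mem_enum_vpaths[rb db] ->]]].
by apply/mem_enum_vpaths; rewrite rng_comp // deg_comp // da db.
Qed.

Lemma enum_vpaths0 v : enum_vpaths v 0 = [:: idm v].
Proof.
apply/perm_small_eq => //; apply: uniq_perm => //; first exact: enum_vpaths_uniq.
move=> l; rewrite inE; apply/idP/eqP => [/mem_enum_vpaths[rl dl]|->].
  apply: (is_prefix_inj (is_prefix_refl l)); last by rewrite dl deg_id.
  by exists l; rewrite ?src_id -?rl ?comp_idl.
by apply/mem_enum_vpaths; rewrite rng_id deg_id.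
Qed.

Lemma enum_vpaths_neq0 (Lns : no_sources L) v m : enum_vpaths v m != [::].
Proof.
have [a /mem_enum_vpaths] := Lns v m.
by case: (enum_vpaths v m).
Qed.

End VertexPaths.

Section TalentedLimit.
Variables (k : nat) (L : kgraph k).
Hypotheses (Lfin : row_finite L) (Lns : no_sources L).
Local Notation gen := (kobj L * zvec k)%type.
Local Notation cong := (cmon_cong (@talented_rel k L)).
Implicit Types (v : kobj L) (s t : seq gen) (g : gen).

(** The defining relation of the talented monoid, extended from the degrees [e_i]
to all degrees. *)
Lemma tvertex_sum v (n : zvec k) (m : nvec k) :
  tvertex v n = \sum_(a <- enum_vpaths v m) tvertex (src a) (n + zof m).
Proof.
elim/nvec_ind: m => [|m i IHm].
  by rewrite enum_vpaths0 // big_seq1 src_id zof0 addr0.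
rewrite IHm (perm_big _ (enum_vpathsD Lfin _ _ _)) big_allpairs_dep /=.
apply: eq_bigr => a _; rewrite /tvertex /pgen.
transitivity (pclass (@talented_rel k L)
    [seq (src b, (n + zof m) + zof (nbasis i)) | b <- enum_vpaths (src a) (nbasis i)]).
  apply/pclassP/cmon_rel/TalentedRel.
  - exact: enum_vpaths_uniq.
  - by apply/seteqP; split=> b /=; rewrite mem_enum_vpaths.
  - exact: enum_vpaths_neq0.
rewrite pclassE big_map; rewrite big_seq [RHS]big_seq; apply: eq_bigr => b.
by move=> /(mem_enum_vpaths Lfin)[rb _]; rewrite src_comp // zofD addrA.
Qed.

(** The expression of a generator below level [N] by generators of level [N]. *)
Definition push N g : seq gen :=
  [seq (src a, zcst k N) | a <- enum_vpaths g.1 (gap N g.2)].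

Definition push_word N s : seq gen := flatten [seq push N g | g <- s].

Lemma push_word_cat N s t : push_word N (s ++ t) = push_word N s ++ push_word N t.
Proof. by rewrite /push_word map_cat flatten_cat. Qed.

Lemma pclass_push_word N s : (forall g, g \in s -> below N g.2) ->
  pclass (@talented_rel k L) (push_word N s) = pclass (@talented_rel k L) s.
Proof.
move=> sN; rewrite !pclassE /push_word big_flatten big_map big_seq [RHS]big_seq.
apply: eq_bigr => -[v n] /sN /= nN; rewrite big_map /=.
by rewrite -/(tvertex v n) (tvertex_sum v n (gap N n)) gapK.
Qed.

Lemma word_below_near s :
  exists N0, forall N, (N0 <= N)%N -> forall g, g \in s -> below N g.2.
Proof.
elim: s => [|g s [N0 sN0]]; first by exists 0%N.
have [N1 gN1] := below_near g.2; exists (maxn N0 N1) => N.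
rewrite geq_max => /andP[N0N N1N] h; rewrite inE => /orP[/eqP->|]; first exact: gN1.
exact: sN0.
Qed.

(** Congruent words become equal, up to reordering, at all high enough levels: at
a level above the generators involved, the defining relation becomes the partition
of the paths of degree [gap N n] by their initial segment of degree [e_i]. *)
Lemma push_word_cong s t : cong s t ->
  exists N0, forall N, (N0 <= N)%N -> perm_eq (push_word N s) (push_word N t).
Proof.
elim=> {s t} [s t|x y|s|s t _ [N0 st]|s t u _ [N0 st] _ [N1 tu]|
              s t s' t' _ [N0 st] _ [N1 st']].
- case=> v n i e eU eE _; have [N0 nN0] := below_near (n + zof (nbasis i)).
  exists N0 => N /nN0 nN; rewrite /push_word /= cats0 /push /=.
  rewrite (gap_addr nN) (perm_trans (perm_map _ (enum_vpathsD Lfin _ _ _))) //.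
  have ev : perm_eq (enum_vpaths v (nbasis i)) e.
    apply: uniq_perm => //; first exact: enum_vpaths_uniq.
    move=> a; apply/idP/idP => [/(mem_enum_vpaths Lfin)|ae].
      by change (vpaths v (nbasis i) a -> a \in e); rewrite -eE.
    by apply/(mem_enum_vpaths Lfin); change (vpaths v (nbasis i) a); rewrite -eE.
  rewrite map_allpairs -map_comp.
  apply: (@perm_trans _ (flatten [seq [seq (src b, zcst k N) |
      b <- enum_vpaths (src a) (gap N (n + zof (nbasis i)))]
      | a <- enum_vpaths v (nbasis i)])); last first.
    by apply: perm_flatten; exact: perm_map.
  apply: (@eq_ind _ _ (perm_eq _) (perm_refl _)); congr flatten.
  apply: eq_map => a; apply/eq_in_map => b /(mem_enum_vpaths Lfin)[rb _].
  by rewrite src_comp.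
- exists 0%N => N _; rewrite -cat1s -[[:: y; x]]cat1s !push_word_cat.
  by rewrite perm_catC.
- by exists 0%N.
- by exists N0 => N /st; rewrite perm_sym.
- exists (maxn N0 N1) => N; rewrite geq_max => /andP[/st sN /tu].
  exact: perm_trans.
- exists (maxn N0 N1) => N; rewrite geq_max => /andP[/st sN /st' sN'].
  by rewrite !push_word_cat perm_cat.
Qed.

Lemma push_word_eq0 N s : push_word N s = [::] -> s = [::].
Proof.
case: s => // g s; rewrite /push_word /= /push.
by have := enum_vpaths_neq0 Lfin Lns g.1 (gap N g.2); case: enum_vpaths.
Qed.

Lemma talented_conical : conical (talented L).
Proof.
move=> x y; rewrite -(pclass_repr x) -(pclass_repr y) -pclassD => /pclassP.
move=> /push_word_cong[N /(_ N (leqnn N)) /perm_nilP/push_word_eq0].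
by case: (repr x) => //=; case: (repr y).
Qed.

Lemma pclass_perm s t : perm_eq s t ->
  pclass (@talented_rel k L) s = pclass (@talented_rel k L) t.
Proof. by move=> st; rewrite !pclassE; exact: perm_big. Qed.

Lemma talented_refinement : refinement_monoid (talented L).
Proof.
move=> a b c d; rewrite -(pclass_repr a) -(pclass_repr b) -(pclass_repr c).
rewrite -(pclass_repr d) -!pclassD => /pclassP/push_word_cong[N0 N0P].
have [Na aN] := word_below_near (repr a); have [Nb bN] := word_below_near (repr b).
have [Nc cN] := word_below_near (repr c); have [Nd dN] := word_below_near (repr d).
pose N := (N0 + Na + Nb + Nc + Nd)%N.
have := N0P N; rewrite !push_word_cat => /(_ ltac:(rewrite /N; lia)).
move=> /perm_cat_refine[z1 [z2 [z3 [z4 [az bz cz dz]]]]].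
exists (pclass _ z1), (pclass _ z2), (pclass _ z3), (pclass _ z4).
rewrite -!pclassD -(pclass_perm az) -(pclass_perm bz) -(pclass_perm cz).
rewrite -(pclass_perm dz) !pclass_push_word //.
- by apply: dN; rewrite /N; lia.
- by apply: cN; rewrite /N; lia.
- by apply: bN; rewrite /N; lia.
- by apply: aN; rewrite /N; lia.
Qed.

End TalentedLimit.

(** * Compact open sets of infinite paths and of arrows *)

Section Topology.
Variables (k : nat) (L : kgraph k).
Implicit Types (x y z : infpath L) (l m : kmor L) (g h : parr L) (n : nvec k).

(** The cylinder set [Z(l)] of the infinite paths that begin with [l]. *)
Definition vcyl l : set (infpath L) := [set x | ihead x (deg l) = l].

Lemma vcyl_idm (v : kobj L) x : vcyl (idm v) x <-> irange x = v.
Proof.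
rewrite /vcyl /= deg_id; split=> [/(congr1 (@rng _ _))|xv].
  by rewrite rng_ihead rng_id.
apply: (@is_prefix_inj _ _ _ _ (ihead x 0)); rewrite ?deg_ihead ?deg_id //.
  exact: is_prefix_refl.
by exists (ihead x 0); rewrite ?src_id ?rng_ihead // -xv -(rng_ihead x 0) comp_idl.
Qed.

(** Membership in [Z(l, m)], without the common tail [z]. *)
Lemma cylinderE l m g : cylinder l m g <->
  [/\ ihead (prng g) (deg l) = l, ihead (psrc g) (deg m) = m,
      pdeg g = zof (deg l) - zof (deg m) &
      ishift (deg l) (prng g) = ishift (deg m) (psrc g)].
Proof.
split=> [[z [zl [_ hl sl] dg [_ hm sm]]]|[hl hm dg s]]; first by split; rewrite ?sl.
exists (ishift (deg l) (prng g)); rewrite irange_shift -src_ihead hl; split=> //.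
  by split; rewrite ?irange_shift -?src_ihead ?hl.
by split; rewrite ?s // irange_shift -src_ihead hm.
Qed.

Lemma open_cylinder l m : src l = src m -> open (cylinder l m).
Proof.
move=> lm; exists [set cylinder l m]; last by rewrite bigcup_set1.
by move=> _ ->; exists l, m.
Qed.

Lemma nbhs_parr g (A : set (parr L)) : nbhs g A ->
  exists l m, cylinder l m g /\ cylinder l m `<=` A.
Proof.
rewrite nbhsE => -[_ [[D DL <-] [U DU Ug]] DA].
have [l [m [lm UE]]] := DL _ DU; exists l, m; rewrite -UE; split=> //.
by move=> h Uh; apply: DA; exists U.
Qed.

Lemma open_vcyl l : open (vcyl l).
Proof.
exists (cylinder l l); first exact: open_cylinder.
apply/seteqP; split=> x; first by move=> /cylinderE[].
by move=> xl; apply/cylinderE; split; rewrite //= subrr.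
Qed.

Lemma nbhs_infpath x (A : set (infpath L)) : nbhs x A ->
  exists n, forall y, ihead y n = ihead x n -> A y.
Proof.
rewrite nbhsE => -[_ [[C oC <-] Cx] CA].
have [|l [m [lm lmC]]] := @nbhs_parr (punit x) C; first exact: open_nbhs_nbhs.
have [/= xl xm d _] := (cylinderE l m (punit x)).1 lm.
have dlm : deg l = deg m by apply: zof_inj; apply/eqP; rewrite -subr_eq0 -d.
have ml : m = l by rewrite -xm -dlm.
exists (deg l) => y yx; apply/CA/lmC/cylinderE.
by rewrite ml subrr /= yx.
Qed.

Lemma ultra_bigcup_seq (T : Type) (I : eqType) (F : set_system T)
    (FU : UltraFilter F) (s : seq I) (A : I -> set T) :
  F [set x | exists2 i, i \in s & A i x] -> exists i, F (A i).
Proof.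
elim: s => [|i s IHs] Fs.
  by have [x []] := @filter_ex _ F _ _ Fs.
have [Fi|Fi] := in_ultra_setVsetC (A i) FU; first by exists i.
apply: IHs; apply: filterS2 Fs Fi => x [j]; rewrite inE => /orP[/eqP->|] //.
by move=> js Aj _; exists j.
Qed.

Hypothesis Lfin : row_finite L.

(** By row-finiteness [Z(l)] is, for each [N], a finite union of cylinders of
degree [d(l) + (N, ..., N)]; an ultrafilter contains one of them for each [N], and
these define its limit. *)
Lemma compact_vcyl l : compact (vcyl l).
Proof.
rewrite compact_ultra => F FU Fl.
have step N : exists l', deg l' = deg l + ncst k N /\ F (vcyl l').
  have [|a Fa] := @ultra_bigcup_seq _ _ F FU
      [seq comp l a | a <- enum_vpaths (src l) (ncst k N)]
      (fun l' => [set x | vcyl l' x /\ deg l' = deg l + ncst k N]).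
    apply: filterS Fl => x; rewrite /vcyl /= => xl.
    have xE : ihead x (deg l + ncst k N) = comp l (ihead (ishift (deg l) x) (ncst k N)).
      by rewrite -ihead_shift xl.
    exists (ihead x (deg l + ncst k N)); last by rewrite /vcyl /= !deg_ihead.
    apply/mapP; exists (ihead (ishift (deg l) x) (ncst k N)) => //.
    apply/mem_enum_vpaths => //.
    by rewrite rng_ihead irange_shift -src_ihead xl deg_ihead.
  have [x [_ da]] := @filter_ex _ F _ _ Fa.
  by exists a; split=> //; apply: filterS Fa => y [].
have [g dg] := choice step.
have gF N : F (vcyl (g N)) by case: (dg N).
have {}dg N : deg (g N) = deg l + ncst k N by case: (dg N).
have [N|N|x xg] := @path_of_chain _ _ g.
- by rewrite dg addrC nle_add.
- have [y [yN yN1]] := @filter_ex _ F _ _ (filterI (gF N) (gF N.+1)).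
  rewrite -yN -yN1; apply: is_prefix_iheads; rewrite !dg ![deg l + _]addrC.
  by rewrite nle_add2r nle_ncst.
exists x; split.
- have [y [yl y0]] := @filter_ex _ F _ _ (filterI Fl (gF 0%N)).
  rewrite /vcyl /= -[RHS]yl; apply: (@ihead_le _ _ _ _ (deg (g 0%N))).
    by rewrite dg nle_add.
  by rewrite xg y0.
- move=> A /nbhs_infpath[n nA]; apply: filterS (gF (nmax n)) => y yg; apply: nA.
  apply: (@ihead_le _ _ _ _ (deg (g (nmax n)))); last by rewrite yg xg.
  by apply: nle_trans (nle_nmax n) _; rewrite dg addrC nle_add.
Qed.

(** The arrow [(l z, d(l) - d(m), m z)] of [Z(l, m)] depends continuously on its
tail [z]. *)
Lemma cylinder_nbhs l m g (A : set (parr L)) : cylinder l m g -> nbhs g A ->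
  exists a, forall h, cylinder l m h ->
    ihead (ishift (deg l) (prng h)) a = ihead (ishift (deg l) (prng g)) a -> A h.
Proof.
move=> lmg /nbhs_parr[l' [m' [lmg' lmA]]].
have [gl gm dg sg] := (cylinderE l m g).1 lmg.
have [gl' gm' dg' sg'] := (cylinderE l' m' g).1 lmg'.
pose a := nsub (deg l') (deg l); pose a' := nsub (deg l) (deg l').
have eal : deg l + a = deg l' + a' by exact: nsub_join.
have eam : deg m + a = deg m' + a'.
  apply: zof_inj; apply: (addrI (pdeg g)); rewrite !zofD !addrA {1}dg dg' !subrK.
  by rewrite -!zofD eal.
exists a => h /cylinderE[hl hm dh sh] hga; apply/lmA.
apply: (cylinder_lengthen (a := a') lmg'); rewrite -eal -eam.
apply/cylinderE; rewrite !deg_ihead; split.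
- by rewrite -!ihead_shift hl gl hga.
- by rewrite -!ihead_shift hm gm -sh -sg hga.
- by rewrite dh !zofD opprD addrACA subrr addr0.
- by rewrite ![_ + a]addrC -!ishiftD sh.
Qed.

Lemma cylinder_inj l m g h : cylinder l m g -> cylinder l m h ->
  ishift (deg l) (prng g) = ishift (deg l) (prng h) -> g = h.
Proof.
move=> /cylinderE[gl gm dg sg] /cylinderE[hl hm dh sh] e; apply: parr_eq.
- by apply: (infpath_determined _ e); rewrite gl hl.
- by rewrite dg dh.
- apply: (@infpath_determined _ _ _ _ (deg m)); first by rewrite gm hm.
  by rewrite -sg -sh.
Qed.

Lemma cylinder_arrow l m z : src l = src m -> irange z = src l ->
  exists g, [/\ cylinder l m g, is_prepend l z (prng g) & is_prepend m z (psrc g)].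
Proof.
move=> lm zl; have [x xl] := prepend_exists zl.
have [y ym] := prepend_exists (etrans zl lm).
have P : exists n n' : nvec k,
    zof (deg l) - zof (deg m) = zof n - zof n' /\ ishift n x = ishift n' y.
  by exists (deg l), (deg m); case: xl ym => _ _ -> [_ _ ->].
by exists (PArr P); split=> //; exists z; split.
Qed.

(** [Z(l, m)] is the image of the compact set [Z(s(l))] under the continuous map
[z |-> (l z, d(l) - d(m), m z)]. *)
Lemma compact_cylinder l m : src l = src m -> compact (cylinder l m).
Proof.
move=> lm; apply/compact_near_coveringP => I F P FF lmP.
have /compact_near_coveringP cv := @compact_vcyl (idm (src l)).
pose Q i z := forall h, cylinder l m h -> ishift (deg l) (prng h) = z -> P i h.
have H := cv I F Q FF; have : \near F, vcyl (idm (src l)) `<=` Q F.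
  apply: H => z /vcyl_idm zl; have [g [lmg [_ _ sg] _]] := cylinder_arrow lm zl.
  have [[A V] /= [gA FV] AVP] := lmP g lmg.
  have [a aA] := cylinder_nbhs lmg gA.
  exists ([set y | ihead y a = ihead z a], V) => /=.
    split=> //; have := @open_vcyl (ihead z a); rewrite /vcyl deg_ihead => o.
    exact: open_nbhs_nbhs.
  move=> [y i] /= [yz Vi] h lmh hy; apply: (AVP (h, i)); split=> //=.
  by apply: aA => //; rewrite hy sg.
apply: filterS => i iQ h lmh; apply: (iQ (ishift (deg l) (prng h))) => //.
apply/vcyl_idm; rewrite irange_shift -src_ihead.
by have [-> _ _ _] := (cylinderE l m h).1 lmh.
Qed.

End Topology.

Lemma compact_open_slice (T : topologicalType) k (U : set T) (n : zvec k) :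
  compact U -> open U -> compact_open (U `*` [set n]).
Proof.
move=> cU oU; split; first exact: compact_setX cU (@compact_set1 _ n).
apply: (@openI _ (fst @^-1` U) (snd @^-1` [set n])).
  by apply: open_comp oU => p _; exact: cvg_fst.
by apply: open_comp (discrete_open [set n]) => p _; exact: cvg_snd.
Qed.

Lemma nbhs_slice (T : topologicalType) k (x : T) (n : zvec k) (A : set (T * zvec k)) :
  nbhs (x, n) A -> nbhs x [set y | A (y, n)].
Proof.
move=> [[U V] /= [xU nV] UV]; apply: filterS xU => y Uy; apply: UV; split=> //=.
exact: nbhs_singleton nV.
Qed.

(** * Boxes in the unit space of the skew product *)

Section Boxes.
Variables (k : nat) (L : kgraph k).
Hypothesis Lfin : row_finite L.
Local Notation SG := (skew_groupoid (@pdeg_cocycle k L)).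
Local Notation box_index := (kmor L * zvec k)%type.
Implicit Types (p q : box_index) (E : seq box_index).

(** The basic compact open set [Z(l) x {n}] of the unit space of the skew
product. *)
Definition box p : set (infpath L * zvec k) := vcyl p.1 `*` [set p.2].

Lemma compact_open_box p : compact_open (box p).
Proof. by apply: compact_open_slice; [exact: compact_vcyl | exact: open_vcyl]. Qed.

Definition copen_box p : copen SG :=
  exist _ (box p) (mem_set (compact_open_box p)).

(** The bisection [Z(l, s(l)) x {n}] has range [Z(l) x {n}] and source
[Z(s(l)) x {n + d(l)}]. *)
Lemma typ_box_src (l : kmor L) (n : zvec k) :
  typ (copen_box (l, n)) = typ (copen_box (idm (src l), n + zof (deg l))).
Proof.
have lm : src l = src (idm (src l)) by rewrite src_id.
apply/pclassP/cmon_sym/cmon_rel.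
apply: (@TypBisection SG (cylinder l (idm (src l)) `*` [set n])).
- by apply: compact_open_slice; [exact: compact_cylinder | exact: open_cylinder].
- split=> -[g i] [h j] /set_mem[/= lg ->] /set_mem[/= lh ->] /= [e]; last first.
    move=> _; congr pair; apply: (cylinder_inj lg lh).
    have [_ _ _ ->] := (cylinderE _ _ g).1 lg.
    by have [_ _ _ ->] := (cylinderE _ _ h).1 lh; rewrite e.
  by congr pair; apply: (cylinder_inj lg lh); rewrite e.
- apply/seteqP; split=> [[z i] [/= zl ->]|_ [[g i] [/= lg ->] <-]] /=.
    have zr := (vcyl_idm _ _).1 zl.
    have [g [lg gz [_ _]]] := cylinder_arrow lm zr.
    rewrite deg_id ishift0 => sg; exists (g, n) => //=; rewrite sg.
    by have [_ _ -> _] := (cylinderE _ _ g).1 lg; rewrite deg_id zof0 subr0.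
  have [_ gm -> _] := (cylinderE _ _ g).1 lg.
  by split=> //=; rewrite deg_id zof0 subr0.
- apply/seteqP; split=> [[x i] [/= xl ->]|_ [[g i] [/= lg ->] <-]] /=; last first.
    by have [gl _ _ _] := (cylinderE _ _ g).1 lg.
  have zr : irange (ishift (deg l) x) = src l by rewrite irange_shift -src_ihead xl.
  have [g [lg gx _]] := cylinder_arrow lm zr; exists (g, n) => //=.
  congr pair; apply: (is_prepend_inj gx); rewrite -[X in is_prepend X]xl.
  exact: is_prepend_ihead.
Qed.

(** The union of a finite family of boxes. *)
Definition box_union E : set (infpath L * zvec k) :=
  [set u | exists2 p, p \in E & box p u].

Lemma box_union_cons p E : box_union (p :: E) = box p `|` box_union E.
Proof.
apply/seteqP; split=> [u [q]|u [pu|[q qE qu]]].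
- by rewrite inE => /orP[/eqP->|qE] qu; [left | right; exists q].
- by exists p; rewrite ?mem_head.
- by exists q; rewrite // inE qE orbT.
Qed.

Lemma compact_open_box_union E : compact_open (box_union E).
Proof.
elim: E => [|p E [cE oE]].
  have -> : box_union [::] = set0 by apply/seteqP; split=> u // [].
  by split; [exact: compact0 | exact: open0].
have [cp op] := compact_open_box p; rewrite box_union_cons.
by split; [exact: compactU | exact: openU].
Qed.

Lemma typ_box_union E (U : copen SG) : uniq E ->
    (forall p q u, p \in E -> q \in E -> box p u -> box q u -> p = q) ->
    val U = box_union E ->
  typ U = \sum_(p <- E) typ (copen_box p).
Proof.
elim: E U => [|p E IHE] U.
  move=> _ _ UE; rewrite big_nil; apply/pclassP/cmon_rel/TypEmpty.
  by apply: etrans UE _; apply/seteqP; split=> u // [].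
move=> /= /andP[pE uE] disj UE.
pose U' : copen SG := exist _ (box_union E) (mem_set (compact_open_box_union E)).
rewrite big_cons -(IHE U') //; last first.
  by move=> q r u qE rE; apply: disj; rewrite inE ?qE ?rE orbT.
rewrite -[RHS]pclassD; apply/pclassP/cmon_rel/TypUnion; last first.
  by apply: etrans UE _; rewrite box_union_cons.
apply/seteqP; split=> u // [/= pu [q qE qu]].
move: pE; rewrite (disj p q u) ?mem_head ?qE // inE qE orbT //.
Qed.

End Boxes.

(** * Cutting a compact open set at a level *)

Section Cut.
Variables (k : nat) (L : kgraph k).
Local Notation unit_space := (infpath L * zvec k)%type.
Local Notation box_index := (kmor L * zvec k)%type.
Implicit Types (U V : set unit_space) (N M : nat) (n : zvec k) (x y : infpath L).

(** The index of the box of level [N] around [(x, n)]: the prefix of [x] of degree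
[N - n], together with [n]. *)
Definition cut N (u : unit_space) : box_index := (ihead u.1 (gap N u.2), u.2).

(** [U] lies below level [N] and is a union of boxes of level [N]. *)
Definition saturated N U : Prop := forall x n, U (x, n) ->
  below N n /\ forall y, ihead y (gap N n) = ihead x (gap N n) -> U (y, n).

Lemma nbhs_cut x n (a : nvec k) :
  nbhs (x, n) [set u : unit_space | u.2 = n /\ ihead u.1 a = ihead x a].
Proof.
exists ([set y | ihead y a = ihead x a], [set n]) => /=; last by move=> u [].
split; last by apply: open_nbhs_nbhs; split=> //; exact: discrete_open.
have := @open_vcyl k L (ihead x a); rewrite /vcyl deg_ihead => o.
exact: open_nbhs_nbhs.
Qed.

Lemma nle_gap_near (a : nvec k) n :
  exists N0, forall N, (N0 <= N)%N -> nle a (gap N n).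
Proof.
have [N0 N0n] := below_near n; exists (N0 + nmax a)%N => N N0N.
have NN : (N0 <= N)%N by apply: leq_trans N0N; rewrite leq_addr.
rewrite (gap_leq NN (N0n _ (leqnn _))) addrC.
apply: (@nle_trans _ (ncst k (N - N0))); last exact: nle_add.
by apply: nle_nmax_le; rewrite leq_subRL.
Qed.

(** Both conditions hold near each point from some level on, so compactness gives
a common level. *)
Lemma saturated_near U : compact_open U ->
  exists N0, forall N, (N0 <= N)%N -> saturated N U.
Proof.
move=> [/compact_near_coveringP cU oU].
pose P N (u : unit_space) := below N u.2 /\
  forall y, ihead y (gap N u.2) = ihead u.1 (gap N u.2) -> U (y, u.2).
suff [N0 _ N0U] : \forall N \near \oo, U `<=` P N.
  by exists N0 => N NN x n /(N0U N NN).
apply: cU => -[x n] Uxn.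
have [a aU] := nbhs_infpath (nbhs_slice (open_nbhs_nbhs (conj oU Uxn))).
have [N0 N0n] := below_near n; have [N1 N1a] := nle_gap_near a n.
exists ([set u : unit_space | u.2 = n /\ ihead u.1 a = ihead x a],
        [set N | (maxn N0 N1 <= N)%N]) => /=.
  by split; [exact: nbhs_cut | exists (maxn N0 N1)].
move=> [[y m] N] /= [[-> yx]]; rewrite geq_max => /andP[/N0n nN /N1a aN].
split=> //= z zy; apply: aU; rewrite -yx; exact: ihead_le zy.
Qed.

(** The indices of the boxes are bounded, in an enumeration of the countable set of
all indices, near each point of [U], hence bounded on [U]. *)
Lemma finite_cut N U : compact U -> saturated N U -> finite_set (cut N @` U).
Proof.
move=> /compact_near_coveringP cU sU.
have [j _ jU] : \forall j \near \oo, U `<=` [set u | (choice.pickle (cut N u) <= j)%N].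
  apply: cU => -[x n] Uxn.
  exists ([set u : unit_space | u.2 = n /\ ihead u.1 (gap N n) = ihead x (gap N n)],
          [set j | (choice.pickle (cut N (x, n)) <= j)%N]) => /=.
    by split; [exact: nbhs_cut | exists (choice.pickle (cut N (x, n)))].
  by move=> [[y m] j] /= [[-> yx]]; rewrite /cut /= yx.
apply: (@sub_finite_set _ _ (choice.pickle @^-1` `I_j.+1)); last first.
  by apply: finite_preimage => // p q _ _; exact: (pcan_inj choice.pickleK).
by move=> _ [u Uu <-]; rewrite /= ltnS; exact: (jU j (leqnn j)).
Qed.

(** The indices of the boxes of level [N] that meet [U], listed without repetition;
the list is empty when there are infinitely many. *)
Definition enum_cut N U : seq box_index := enum_fset (fset_set (cut N @` U)).

Lemma enum_cut_uniq N U : uniq (enum_cut N U).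
Proof. exact: fset_uniq. Qed.

Lemma mem_enum_cut N U p : compact U -> saturated N U ->
  p \in enum_cut N U <-> exists2 u, U u & cut N u = p.
Proof.
move=> cU sU; have := in_fset_set (finite_cut cU sU) p.
by rewrite /enum_cut /= => ->; rewrite inE.
Qed.

End Cut.

(** * The inverse homomorphism *)

Section Value.
Variables (k : nat) (L : kgraph k).
Hypotheses (Lfin : row_finite L) (Lns : no_sources L).
Local Notation SG := (skew_groupoid (@pdeg_cocycle k L)).
Local Notation unit_space := (infpath L * zvec k)%type.
Implicit Types (U V W : set unit_space) (N M : nat) (n : zvec k) (x y : infpath L).

Lemma saturated_leq N M U : (N <= M)%N -> saturated N U -> saturated M U.
Proof.
move=> NM sU x n Uxn; have [nN xU] := sU _ _ Uxn; split; first exact: below_leq nN.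
move=> y yx; apply: xU; apply: ihead_le yx.
by rewrite (gap_leq NM nN) nle_add.
Qed.

(** The candidate for the image of the type of [U] in the talented monoid, computed
at level [N]. *)
Definition cut_sum N U : talented L :=
  \sum_(p <- enum_cut N U) tvertex (src p.1) (zcst k N).

(** Passing from level [N] to level [M] replaces each prefix [l] by all its
extensions by a path of degree [M - N]; that all of them occur uses that each
morphism is the beginning of an infinite path. *)
Lemma enum_cut_leq N M U : (N <= M)%N -> compact U -> saturated N U ->
  perm_eq (enum_cut M U)
    [seq (comp p.1 a, p.2) | p <- enum_cut N U,
                             a <- enum_vpaths (src p.1) (ncst k (M - N))].
Proof.
move=> NM cU sU; have sM := saturated_leq NM sU.
apply: uniq_perm; first exact: enum_cut_uniq.
  apply: allpairs_uniq_dep; first exact: enum_cut_uniq.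
    by move=> p _; exact: enum_vpaths_uniq.
  move=> p q /allpairsPdep[p1 [a [/(mem_enum_cut _ cU sU)[[x n] _ <-] aE ->]]].
  move=> /allpairsPdep[p2 [b [/(mem_enum_cut _ cU sU)[[y m] _ <-] bE ->]]] /=.
  move: aE bE => /(mem_enum_vpaths Lfin)[ra da] /(mem_enum_vpaths Lfin)[rb db].
  case=> e nm; move: ra rb e; rewrite /cut /= -nm => ra rb.
  by move=> /factor_inj[] //; rewrite ?deg_ihead ?da ?db // => -> ->.
move=> [l n]; apply/idP/idP => [/(mem_enum_cut _ cU sM)[[x n'] Ux [xl nn]]|].
  rewrite nn in Ux xl; have [nN _] := sU _ _ Ux.
  apply/allpairsPdep; exists (cut N (x, n)).
  exists (ihead (ishift (gap N n) x) (ncst k (M - N))); split.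
  - by apply/(mem_enum_cut _ cU sU); exists (x, n).
  - apply/(mem_enum_vpaths Lfin); rewrite rng_ihead deg_ihead irange_shift.
    by rewrite /cut /= src_ihead.
  - by rewrite /cut /= ihead_shift -(gap_leq NM nN) xl.
move=> /allpairsPdep[p [a [/(mem_enum_cut _ cU sU)[[x m] Ux <-]]]] /=.
move=> /(mem_enum_vpaths Lfin)[ra da] [-> ->]; rewrite /cut /= in ra *.
have [mN xU] := sU _ _ Ux; apply/(mem_enum_cut _ cU sM).
have dxa : deg (comp (ihead x (gap N m)) a) = gap M m.
  by rewrite deg_comp // deg_ihead da -gap_leq.
have [y yE] := infpath_through Lns (comp (ihead x (gap N m)) a).
exists (y, m); last by rewrite /cut /= -dxa yE.
apply: xU; apply: (@is_prefix_inj _ _ _ _ (ihead y (gap M m))).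
- by apply: is_prefix_iheads; rewrite (gap_leq NM mN) nle_add.
- by rewrite -dxa yE; exists a.
- by rewrite !deg_ihead.
Qed.

Lemma cut_sum_leq N M U : (N <= M)%N -> compact U -> saturated N U ->
  cut_sum M U = cut_sum N U.
Proof.
move=> NM cU sU; rewrite /cut_sum (perm_big _ (enum_cut_leq NM cU sU)).
rewrite big_allpairs_dep; rewrite big_seq [RHS]big_seq; apply: eq_bigr => p _ /=.
rewrite (tvertex_sum Lfin Lns _ _ (ncst k (M - N))) -zcstD subnKC //.
rewrite big_seq [RHS]big_seq; apply: eq_bigr => a /(mem_enum_vpaths Lfin)[ra _].
by rewrite src_comp.
Qed.

(** The value of [U] at any level at which [U] is saturated; the default level [0],
used when there is none, never matters for compact open sets. *)
Definition value U : talented L := cut_sum (xget 0%N [set N | saturated N U]) U.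

Lemma valueE N U : compact U -> saturated N U -> value U = cut_sum N U.
Proof.
move=> cU sN; rewrite /value; set M := xget _ _.
have sM : saturated M U by apply: (@xgetPex _ 0%N [set N | saturated N U]); exists N.
have [NM|/ltnW MN] := leqP N M; first exact: cut_sum_leq.
by rewrite (cut_sum_leq MN).
Qed.

Lemma value_set0 : value set0 = 0.
Proof.
have s0 : saturated 0 (set0 : set unit_space) by [].
rewrite (valueE _ s0); last exact: compact0.
by rewrite /cut_sum /enum_cut image_set0 fset_set0 big_nil.
Qed.

Lemma value_setU U V : compact_open U -> compact_open V -> U `&` V = set0 ->
  value (U `|` V) = value U + value V.
Proof.
move=> oU oV UV; have [cU cV] := (oU.1, oV.1).
have [N0 N0U] := saturated_near oU; have [N1 N1V] := saturated_near oV.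
pose N := maxn N0 N1; have sU : saturated N U by apply: N0U; rewrite leq_maxl.
have sV : saturated N V by apply: N1V; rewrite leq_maxr.
have cW : compact (U `|` V) by exact: compactU.
have sW : saturated N (U `|` V).
  by move=> x n [/sU|/sV] [nN h]; split=> // y /h; [left|right].
rewrite (valueE cW sW) (valueE cU sU) (valueE cV sV) /cut_sum -big_cat.
apply: perm_big; apply: uniq_perm; first exact: enum_cut_uniq.
  rewrite cat_uniq !enum_cut_uniq andbT /=; apply/hasPn => p.
  move=> /(mem_enum_cut _ cV sV)[[y m] Vym <-]; apply/negP.
  move=> /(mem_enum_cut _ cU sU)[[x n] Uxn [xy nm]].
  rewrite nm in xy Uxn; have [_ h] := sU _ _ Uxn.
  suff : (U `&` V) (y, m) by rewrite UV.
  by split=> //; apply: h; rewrite xy.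
move=> p; rewrite mem_cat; apply/idP/orP.
  by move=> /(mem_enum_cut _ cW sW)[u [Uu|Vu] <-]; [left|right];
    apply/mem_enum_cut => //; exists u.
by move=> [/(mem_enum_cut _ cU sU)|/(mem_enum_cut _ cV sV)] [u Uu <-];
  apply/(mem_enum_cut _ cW sW); exists u => //; [left|right].
Qed.

Lemma value_box (v : kobj L) n : value (box (idm v, n)) = tvertex v n.
Proof.
have cB := compact_open_box Lfin (idm v, n); have [N0 N0s] := saturated_near cB.
have [N1 N1n] := below_near n; pose N := maxn N0 N1.
have sN : saturated N (box (idm v, n)) by apply: N0s; rewrite leq_maxl.
have nN : below N n by apply: N1n; rewrite leq_maxr.
rewrite (valueE cB.1 sN) (tvertex_sum Lfin Lns v n (gap N n)) gapK //.
have boxE x m : box (idm v, n) (x, m) <-> irange x = v /\ m = n.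
  by split=> -[] /vcyl_idm.
rewrite /cut_sum (@perm_big _ _ _ _ _
  [seq (a, n) | a <- enum_vpaths v (gap N n)]) ?big_map //=.
apply: uniq_perm; first exact: enum_cut_uniq.
  by rewrite map_inj_uniq ?enum_vpaths_uniq // => a b [].
move=> p; apply/idP/mapP => [/(mem_enum_cut _ cB.1 sN)[[x m] /boxE[xv ->] <-]|].
  by exists (ihead x (gap N n)) => //; apply/mem_enum_vpaths => //; rewrite rng_ihead deg_ihead.
move=> [a /(mem_enum_vpaths Lfin)[ra da] ->].
have [x xa] := infpath_through Lns a; apply/(mem_enum_cut _ cB.1 sN).
exists (x, n); last by rewrite /cut /= -da xa.
by apply/boxE; rewrite -ra -[in rng a]xa rng_ihead.
Qed.

(** Cut at level [N], the two ends of an arrow [(g, n)] of [B] have prefixes [l]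
and [m] followed by the same tail, and all of [Z(l, m) x {n}] lies in [B]. *)
Definition saturated_arrows N (B : set (parr L * zvec k)) : Prop :=
  forall g n, B (g, n) ->
    [/\ below N n, below N (n + pdeg g),
        ishift (gap N n) (prng g) = ishift (gap N (n + pdeg g)) (psrc g) &
        forall h, cylinder (ihead (prng g) (gap N n))
                           (ihead (psrc g) (gap N (n + pdeg g))) h -> B (h, n)].

Lemma saturated_arrows_near (B : set (parr L * zvec k)) : compact_open B ->
  exists N0, forall N, (N0 <= N)%N -> saturated_arrows N B.
Proof.
move=> [/compact_near_coveringP cB oB].
pose P N (w : parr L * zvec k) := [/\ below N w.2, below N (w.2 + pdeg w.1),
  ishift (gap N w.2) (prng w.1) = ishift (gap N (w.2 + pdeg w.1)) (psrc w.1) &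
  forall h, cylinder (ihead (prng w.1) (gap N w.2))
     (ihead (psrc w.1) (gap N (w.2 + pdeg w.1))) h -> B (h, w.2)].
suff [N0 _ N0B] : \forall N \near \oo, B `<=` P N.
  by exists N0 => N NN g n /(N0B N NN).
apply: cB => -[g n] Bgn.
have [l [m [lmg lmB]]] := nbhs_parr (nbhs_slice (open_nbhs_nbhs (conj oB Bgn))).
have lm : src l = src m.
  by case: lmg => z [zl _ _ [zm _ _]]; rewrite -zl.
have [N0 N0n] := below_near n; have [N1 N1l] := nle_gap_near (deg l) n.
exists ([set w | cylinder l m w.1 /\ w.2 = n],
        [set N | (maxn N0 N1 <= N)%N]) => /=.
  split; last by exists (maxn N0 N1).
  exists (cylinder l m, [set n]) => /=; last by move=> w [].
  split; first exact: open_nbhs_nbhs (conj (open_cylinder lm) lmg).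
  by apply: open_nbhs_nbhs; split=> //; exact: discrete_open.
move=> [[h i] N] /= [[lmh ->]]; rewrite geq_max => /andP[/N0n nN /N1l lN].
pose c := nsub (gap N n) (deg l); have gE : gap N n = deg l + c by rewrite nsubK.
have [_ _ dh sh] := (cylinderE l m h).1 lmh.
have gE' : n + pdeg h + zof (deg m + c) = zcst k N.
  by rewrite -(gapK nN) gE dh !zofD !addrA subrK.
have gapE := gap_eq gE'.
split=> //=; first by exists (deg m + c).
  by rewrite gapE gE ![_ + c]addrC -!ishiftD sh.
by move=> h' hh'; apply/lmB; move: hh'; rewrite gapE gE; exact: cylinder_lengthen.
Qed.

(** At a level high enough for [B], [U] and [V], both values are sums over the
pairs formed by the cuts of the two ends of an arrow of [B]: such a pair is
determined by either of its components, and its two paths have the same source. *)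
Lemma value_bisection (B : set (garr SG)) U V :
    compact_open B -> bisection B -> compact_open U -> compact_open V ->
    U = @gsrc SG @` B -> V = @grng SG @` B ->
  value U = value V.
Proof.
move=> oB [rB sB] oU oV UE VE.
have [N0 N0B] := saturated_arrows_near oB.
have [N1 N1U] := saturated_near oU; have [N2 N2V] := saturated_near oV.
pose N := (N0 + N1 + N2)%N.
have {}N0B : saturated_arrows N B by apply: N0B; rewrite /N; lia.
have {}N1U : saturated N U by apply: N1U; rewrite /N; lia.
have {}N2V : saturated N V by apply: N2V; rewrite /N; lia.
rewrite (valueE oU.1 N1U) (valueE oV.1 N2V).
pose cuts (w : parr L * zvec k) :=
  (cut N (psrc w.1, w.2 + pdeg w.1), cut N (prng w.1, w.2)).
have fin : finite_set (cuts @` B).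
  apply: (@sub_finite_set _ _ ((cut N @` U) `*` (cut N @` V))).
    move=> _ [w Bw <-]; split.
      by exists (psrc w.1, w.2 + pdeg w.1) => //; rewrite UE; exists w.
    by exists (prng w.1, w.2) => //; rewrite VE; exists w.
  by apply: finite_setX; apply: finite_cut => //; [case: oU | case: oV].
pose E := enum_fset (fset_set (cuts @` B)).
have EP c : c \in E <-> exists2 w, B w & cuts w = c.
  by have := in_fset_set fin c; rewrite /E /= => ->; rewrite inE.
have pdegE g n : B (g, n) ->
    pdeg g = zof (gap N n) - zof (gap N (n + pdeg g)).
  move=> /N0B[nN nN' _ _]; apply: (addrI n); rewrite addrA gapK //.
  by rewrite -(gapK nN') addrK.
have cyl g n : B (g, n) ->
    cylinder (ihead (prng g) (gap N n)) (ihead (psrc g) (gap N (n + pdeg g))) g.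
  move=> Bgn; have [_ _ s _] := N0B _ _ Bgn.
  by apply/cylinderE; rewrite !deg_ihead -pdegE.
(* If two arrows of [B] have the same cut at one end, an arrow of [B] with the
   same prefixes as the first one shares that end with the second one. *)
have cut_inj g n g' n' : B (g, n) -> B (g', n') ->
    (cuts (g, n)).1 = (cuts (g', n')).1 \/ (cuts (g, n)).2 = (cuts (g', n')).2 ->
  cuts (g, n) = cuts (g', n').
  move=> Bw Bw' e; have [nN nN' s h] := N0B _ _ Bw.
  suff [gg' nn'] : cylinder (ihead (prng g) (gap N n))
      (ihead (psrc g) (gap N (n + pdeg g))) g' /\ n' = n.
    have [e1 e2 e3 _] := (cylinderE _ _ g').1 gg'.
    rewrite !deg_ihead in e1 e2 e3.
    by rewrite /cuts /cut /= nn' e3 -pdegE // e1 e2.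
  have lm : src (ihead (prng g) (gap N n)) =
            src (ihead (psrc g) (gap N (n + pdeg g))).
    by rewrite !src_ihead -!irange_shift s.
  case: e => -[e1 e2].
  - rewrite -e2 in e1.
    have zl : irange (ishift (gap N (n + pdeg g)) (psrc g')) =
              src (ihead (prng g) (gap N n)).
      by rewrite lm e1 irange_shift src_ihead.
    have [g2 [cg2 _ pg2]] := cylinder_arrow lm zl.
    have sg2 : psrc g2 = psrc g'.
      by apply: (is_prepend_inj pg2); rewrite e1; exact: is_prepend_ihead.
    have [_ _ dg2 _] := (cylinderE _ _ g2).1 cg2.
    rewrite !deg_ihead -pdegE // in dg2.
    have : (g2, n) = (g', n').
      apply: sB; rewrite ?inE //=; first exact: h.
      by rewrite sg2 dg2 e2.
    by case=> <- <-.
  - rewrite -e2 in Bw' e1 *.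
    have zl : irange (ishift (gap N n) (prng g')) = src (ihead (prng g) (gap N n)).
      by rewrite e1 irange_shift src_ihead.
    have [g2 [cg2 pg2 _]] := cylinder_arrow lm zl.
    have rg2 : prng g2 = prng g'.
      by apply: (is_prepend_inj pg2); rewrite e1; exact: is_prepend_ihead.
    have : (g2, n) = (g', n).
      apply: rB; rewrite ?inE //=; first exact: h.
      by rewrite rg2.
    by case=> <-.
have uE := fset_uniq (fset_set (cuts @` B)).
rewrite /cut_sum (@perm_big _ _ _ _ (enum_cut N U) [seq c.1 | c <- E]); last first.
  apply: uniq_perm; first exact: enum_cut_uniq.
    rewrite map_inj_in_uniq // => c d /EP[[g n] Bw <-] /EP[[g' n'] Bw' <-] e.
    by apply: cut_inj => //; left.
  move=> p; apply/idP/mapP.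
    move=> /(mem_enum_cut _ oU.1 N1U)[u]; rewrite UE => -[w Bw <-] <-.
    by exists (cuts w) => //; apply/EP; exists w.
  move=> [_ /EP[w Bw <-] ->]; apply/(mem_enum_cut _ oU.1 N1U).
  by exists (psrc w.1, w.2 + pdeg w.1) => //; rewrite UE; exists w.
rewrite (@perm_big _ _ _ _ (enum_cut N V) [seq c.2 | c <- E]); last first.
  apply: uniq_perm; first exact: enum_cut_uniq.
    rewrite map_inj_in_uniq // => c d /EP[[g n] Bw <-] /EP[[g' n'] Bw' <-] e.
    by apply: cut_inj => //; right.
  move=> p; apply/idP/mapP.
    move=> /(mem_enum_cut _ oV.1 N2V)[u]; rewrite VE => -[w Bw <-] <-.
    by exists (cuts w) => //; apply/EP; exists w.
  move=> [_ /EP[w Bw <-] ->]; apply/(mem_enum_cut _ oV.1 N2V).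
  by exists (prng w.1, w.2) => //; rewrite VE; exists w.
rewrite !big_map; rewrite big_seq [RHS]big_seq; apply: eq_bigr => c /EP[[g n] Bw <-].
have [_ _ s _] := N0B _ _ Bw.
by rewrite /cuts /cut /= !src_ihead -!irange_shift s.
Qed.

End Value.

(** * The isomorphism *)

(** A map from the generators to a commutative monoid which respects the relations
extends to the presented monoid. *)
Lemma cmon_cong_sum (X : choiceType) (R : seq X -> seq X -> Prop) (M : nmodType)
    (f : X -> M) :
  (forall s t, R s t -> \sum_(x <- s) f x = \sum_(x <- t) f x) ->
  forall s t, cmon_cong R s t -> \sum_(x <- s) f x = \sum_(x <- t) f x.
Proof.
move=> fR s t; elim=> {s t} [s t|x y|s|s t _ ->|s t u _ -> _ ->|s t s' t' _ st _ st'] //.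
- exact: fR.
- by rewrite !big_cons !big_nil !addr0 addrC.
- by rewrite !big_cat st st'.
Qed.

Section Isomorphism.
Variables (k : nat) (L : kgraph k).
Hypotheses (Lfin : row_finite L) (Lns : no_sources L).
Local Notation SG := (skew_groupoid (@pdeg_cocycle k L)).
Local Notation gen := (kobj L * zvec k)%type.

(** The box [Z(v) x {n}] associated with the generator [v(n)]. *)
Definition vertex_box (g : gen) : copen SG := copen_box Lfin (idm g.1, g.2).

(** The type of [U] is the sum of the types of the boxes [Z(s(l)) x {N}], for [l] in
the cut of [U] at level [N]. *)
Lemma typ_cut N (U : copen SG) : saturated N (val U) ->
  typ U = \sum_(p <- enum_cut N (val U)) typ (vertex_box (src p.1, zcst k N)).
Proof.
move=> sU; have oU : compact_open (val U) := set_mem (valP U).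
have memE p := mem_enum_cut p oU.1 sU.
rewrite (@typ_box_union _ _ Lfin (enum_cut N (val U))).
- rewrite big_seq [RHS]big_seq; apply: eq_bigr => -[l n] /memE[[x m] Ux [xl mn]].
  have [mN _] := sU _ _ Ux; rewrite typ_box_src -xl deg_ihead -mn gapK //.
- exact: enum_cut_uniq.
- move=> [l n] [l' n'] [x m] /memE[[y i] Uy [<- <-]] /memE[[z j] Uz [<- <-]].
  rewrite /box /vcyl /= !deg_ihead => -[e1 e2] [e3 e4].
  by rewrite -e2 -e4 in e1 e3 *; rewrite -e1 -e3.
- apply/seteqP; split=> [[x m] Ux|[x m] [[l n] /memE[[y i] Uy [<- <-]]]].
    exists (cut N (x, m)); first by apply/memE; exists (x, m).
    by rewrite /box /vcyl /cut /= deg_ihead.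
  rewrite /box /vcyl /= deg_ihead => -[xy ->].
  by have [_ h] := sU _ _ Uy; exact: h.
Qed.

Lemma vertex_box_rel s t : talented_rel s t ->
  cmon_cong (@typ_rel SG) (map vertex_box s) (map vertex_box t).
Proof.
case=> v n i e eU eE _; apply/pclassP.
have memE a : a \in e <-> rng a = v /\ deg a = nbasis i.
  by change ([set` e] a <-> vpaths v (nbasis i) a); rewrite eE.
pose E := [seq (a, n) | a <- e].
transitivity (\sum_(p <- E) typ (copen_box Lfin p)).
  apply: (@typ_box_union _ _ Lfin E (vertex_box (v, n))).
  - by rewrite map_inj_uniq // => a b [].
  - move=> _ _ [x m] /mapP[a /memE[_ da] ->] /mapP[b /memE[_ db] ->].
    by rewrite /box /vcyl /= da db => -[-> _] [-> _].
  - apply/seteqP; split=> [[x m] [/= /vcyl_idm xv ->]|[x m] [_ /mapP[a /memE[ra da] ->]]].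
      exists (ihead x (nbasis i), n); last by rewrite /box /vcyl /= deg_ihead.
      by apply/map_f/memE; rewrite rng_ihead deg_ihead.
    rewrite /box /vcyl /= => -[xa ->]; split=> //=; apply/vcyl_idm.
    by rewrite -ra -[in rng a]xa rng_ihead.
rewrite pclassE !big_map big_seq [RHS]big_seq; apply: eq_bigr => a /memE[_ da].
by rewrite typ_box_src da.
Qed.

(** The homomorphism sending [v(n)] to the type of [Z(v) x {n}]. *)
Definition talented_to_typ : talented L -> groupoid_talented (@pdeg_cocycle k L) :=
  pmap_word (@typ_rel SG) vertex_box.

HB.instance Definition _ :=
  GRing.isNmodMorphism.Build (talented L) (groupoid_talented (@pdeg_cocycle k L))
    talented_to_typ (conj (pmap_word0 vertex_box_rel) (pmap_wordD vertex_box_rel)).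

Lemma talented_to_typ_vertex v n :
  talented_to_typ (tvertex v n) = typ (vertex_box (v, n)).
Proof. exact: (pmap_wordE vertex_box_rel [:: (v, n)]). Qed.

(** The homomorphism sending the type of [U] to its value, through the chosen
representative words. *)
Definition typ_to_talented (u : groupoid_talented (@pdeg_cocycle k L)) : talented L :=
  \sum_(U <- repr u) value (val U).

Lemma typ_to_talentedE s :
  typ_to_talented (pclass (@typ_rel SG) s) = \sum_(U <- s) value (val U).
Proof.
apply: (cmon_cong_sum _ (cmon_cong_repr _ s)) => {}s t.
have co (U : copen SG) : compact_open (val U) := set_mem (valP U).
case=> [U U0|B U V oB bB UE VE|U V W UV WE]; rewrite ?big_cons !big_nil ?addr0.
- by rewrite U0 value_set0.
- exact: (value_bisection _ _ oB bB (co U) (co V)).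
- by rewrite WE value_setU.
Qed.

Lemma talented_to_typK : cancel talented_to_typ typ_to_talented.
Proof.
move=> x; rewrite -(pclass_repr x) [talented_to_typ _](pmap_wordE vertex_box_rel).
rewrite typ_to_talentedE big_map pclassE; apply: eq_bigr => -[v n] _.
exact: value_box.
Qed.

Lemma typ_to_talentedK : cancel typ_to_talented talented_to_typ.
Proof.
move=> u; rewrite -(pclass_repr u) typ_to_talentedE pclassE raddf_sum.
apply: eq_bigr => U _; have oU : compact_open (val U) := set_mem (valP U).
have [N /(_ _ (leqnn N)) sU] := saturated_near oU.
rewrite (valueE _ _ oU.1 sU) // raddf_sum /= -/(typ U) (typ_cut sU).
by apply: eq_bigr => p _; exact: talented_to_typ_vertex.
Qed.

Lemma talented_to_typ_act (n : zvec k) x :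
  talented_to_typ (zact n x) = zact n (talented_to_typ x).
Proof.
rewrite -(pclass_repr x) [zact n _](pmap_wordE (@tshift_rel _ _ n)).
rewrite [LHS](pmap_wordE vertex_box_rel).
rewrite [talented_to_typ _](pmap_wordE vertex_box_rel).
rewrite [RHS](pmap_wordE (@typ_rel_translate _ _ _ _ n)) -!map_comp.
congr pclass; apply: eq_map => -[v m]; apply: val_inj => /=.
apply/seteqP; split=> [[x' p]|_ [[x' p] [/= xv ->] <-]].
  by rewrite /box /= => -[xv ->]; exists (x', m) => //=; rewrite /translate /= addrC.
by split=> //=; rewrite addrC.
Qed.

End Isomorphism.

Theorem theorem3p18 (k : nat) (L : kgraph k)
  (k_gt0 : (0 < k)%N) (Lfin : row_finite L) (Lns : no_sources L) :
  zk_isomorphic (talented L) (groupoid_talented (@pdeg_cocycle k L)) /\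
  (conical (talented L) /\ refinement_monoid (talented L)).
Proof.
split; last first.
  by split; [exact: talented_conical | exact: talented_refinement].
exists (talented_to_typ Lfin : {additive _ -> _}); split.
  exists (@typ_to_talented k L).
    exact: talented_to_typK.
  exact: typ_to_talentedK.
exact: talented_to_typ_act.
Qed.
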